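(* Let $p,q$ be nonnegative integers, let $\kappa_1,\dots,\kappa_p,\mu_1,\dots,\mu_q$ be complex numbers none of which is in $\{0,-1,-2,\dots\}$, let $\alpha,\beta\in\mathbb{C}$ with $\Re(\alpha)>0$, and let $x,y,\omega,w\in\mathbb{C}$ with $\Re(x)>0$, $\Re(y)>0$, $\Re(\omega)>0$, $\Re(w)>0$. Then the beta transform in $\rho$ of the M-beta function is $$\int_0^1 \rho^{\omega-1}(1-\rho)^{w-1}\;{}^{M}B_{p,q}^{(\alpha,\beta)}(\kappa_1,\dots,\kappa_p;\mu_1,\dots,\mu_q;x,y;\rho)\,d\rho = B(\omega,w)\;{}^{M}B_{p+1,q+1}^{(\alpha,\beta)}\left(\kappa_{1},\ldots,\kappa_p,\omega;\mu_1,\ldots,\mu_q,\omega+w; x,y;1\right).$$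
   Context: $(\lambda)_m=\Gamma(\lambda+m)/\Gamma(\lambda)$, $(\lambda)_0=1$ is the Pochhammer symbol and $B(x,y)=\int_0^1 t^{x-1}(1-t)^{y-1}dt$ is the classical beta function. The generalized M-series is $${}_{p}^{\alpha}M^{\beta}_{q}(\kappa_{1},\ldots,\kappa_{p};\mu_{1},\ldots,\mu_{q};z)=\sum_{m=0}^{\infty}\frac{(\kappa_{1})_{m}\cdots(\kappa_p)_{m}}{(\mu_1)_{m}\cdots(\mu_q)_{m}}\frac{z^{m}}{\Gamma(\alpha m+\beta)}.$$ The modified beta (M-beta) function is $${}^{M}B_{p,q}^{(\alpha,\beta)}(\kappa_{1},\ldots,\kappa_p;\mu_1,\ldots,\mu_q;x,y;\rho)=\int_{0}^{1}t^{x-1}(1-t)^{y-1}\,{}_{p}^{\alpha}M^{\beta}_{q}\left(\kappa_{1},\ldots,\kappa_{p};\mu_{1},\ldots,\mu_{q};\frac{-\rho}{t(1-t)}\right) dt.$$ These functions are defined for those parameters and arguments for which the series and integrals converge. *)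

(* Defs.v *)
From mathcomp Require Import all_boot all_order all_algebra.
From mathcomp Require Import complex.
From mathcomp Require Import all_classical all_reals all_analysis.

Set Implicit Arguments.
Unset Strict Implicit.
Unset Printing Implicit Defensive.

Import Order.TTheory GRing.Theory Num.Theory.
Import numFieldNormedType.Exports.

Local Open Scope classical_set_scope.
Local Open Scope ring_scope.
Local Open Scope complex_scope.

Section Defs.
Context {R : realType}.
Implicit Types (t : R) (z alpha beta x y rho : R[i]) (kappa mu : seq R[i]).

Definition cexp z : R[i] :=
  (expR (complex.Re z))%:C * (cos (complex.Im z) +i* sin (complex.Im z)).

(* Principal value of t ^ z; only meaningful for t > 0 (ln is 0 elsewhere). *)
Definition cpow t z : R[i] := cexp (z * (ln t)%:C).

(* Lebesgue integral over the open interval (0, 1) of a complex-valued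
   function, taken componentwise. *)
Definition Cintegrable01 (f : R -> R[i]) : Prop :=
  (@lebesgue_measure R).-integrable `]0%R, 1%R[
    (EFin \o (fun t => complex.Re (f t))) /\
  (@lebesgue_measure R).-integrable `]0%R, 1%R[
    (EFin \o (fun t => complex.Im (f t))).

Definition Cintegral01 (f : R -> R[i]) : R[i] :=
  (\int[@lebesgue_measure R]_(t in `]0%R, 1%R[) complex.Re (f t)) +i*
  (\int[@lebesgue_measure R]_(t in `]0%R, 1%R[) complex.Im (f t)).

(* Gauss' product: the limit of n! n^z / (z (z+1) ... (z+n)).  At a pole
   z = 0, -1, -2, ... the denominators eventually vanish and, since 0^-1 = 0,
   cGamma z = 0; hence (cGamma z)^-1 is the entire function 1/Gamma. *)
Definition cGamma z : R[i] :=
  limn ((fun n : nat =>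
    n`!%:R * cpow n%:R z / \prod_(k < n.+1) (z + k%:R)) : nat -> R[i]^o).

Definition pochhammer z (m : nat) : R[i] :=
  if m == 0%N then 1 else cGamma (z + m%:R) / cGamma z.

Definition cBeta x y : R[i] :=
  Cintegral01 (fun t => cpow t (x - 1) * cpow (1 - t) (y - 1)).

Definition not_nonpos_int z : Prop := forall n : nat, z != - n%:R.

Definition Mterm alpha beta kappa mu z (m : nat) : R[i]^o :=
  (\prod_(k <- kappa) pochhammer k m) / (\prod_(u <- mu) pochhammer u m) *
  (z ^+ m / cGamma (alpha * m%:R + beta)).

Definition Mseries_cvg alpha beta kappa mu z : Prop :=
  cvgn (series (Mterm alpha beta kappa mu z)).

Definition Mseries alpha beta kappa mu z : R[i] :=
  limn (series (Mterm alpha beta kappa mu z)).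

Definition MBeta_arg rho t : R[i] := - rho / (t * (1 - t))%:C.

Definition MBeta_integrand alpha beta kappa mu x y rho t : R[i] :=
  cpow t (x - 1) * cpow (1 - t) (y - 1) *
  Mseries alpha beta kappa mu (MBeta_arg rho t).

Definition MBeta_defined alpha beta kappa mu x y rho : Prop :=
  (forall t, 0 < t < 1 -> Mseries_cvg alpha beta kappa mu (MBeta_arg rho t)) /\
  Cintegrable01 (MBeta_integrand alpha beta kappa mu x y rho).

Definition MBeta alpha beta kappa mu x y rho : R[i] :=
  Cintegral01 (MBeta_integrand alpha beta kappa mu x y rho).

Definition beta_transform_integrand (omega w : R[i]) (f : R -> R[i]) t : R[i] :=
  cpow t (omega - 1) * cpow (1 - t) (w - 1) * f t.

Definition beta_transform (omega w : R[i]) (f : R -> R[i]) : R[i] :=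
  Cintegral01 (beta_transform_integrand omega w f).

End Defs.

(* Main.v *)
Require Import Defs.
From mathcomp Require Import all_boot all_order all_algebra.
From mathcomp Require Import complex.
From mathcomp Require Import all_classical all_reals all_analysis.
From mathcomp Require Import measurable_realfun ring lra.
Import Order.TTheory GRing.Theory Num.Theory.
Import numFieldNormedType.Exports.
Local Open Scope ring_scope.
Local Open Scope complex_scope.

(* Write F(s) for the M-series at -s.  The hypothesis at points t near 0 makes F entire, so
   that, for s >= 0, integrating the series of F(rho s) termwise against
   rho^(omega-1) (1-rho)^(w-1) multiplies its m-th coefficient by
   B(omega+m, w) = B(omega, w) (omega)_m / (omega+w)_m and gives B(omega, w) times the
   (p+1, q+1)-series.  The theorem is then Fubini's theorem for
     rho^(omega-1) (1-rho)^(w-1) t^(x-1) (1-t)^(y-1) F(rho / (t (1-t))).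
   The absolute integrability comes from a bound, uniform in rho, on
     int_0^1 t^(a-1) (1-t)^(b-1) |F(rho / (t (1-t)))| dt,   a = Re x, b = Re y:
   the values of F on [0, 6] contribute a multiple of B(a, b); the rest lives near the end points,
   where the substitution u = t (1-t) / rho turns it into rho^a (or rho^b) times an integral which,
   up to constants, is the one for rho = 1/2.  Finally B(omega, w) <> 0 is what makes the
   (p+1, q+1)-side integrable. *)

Set Implicit Arguments.
Unset Strict Implicit.
Unset Printing Implicit Defensive.

(** * Complex numbers through their real and imaginary parts *)

Section ComplexBasics.
Local Open Scope classical_set_scope.
Context {R : realType}.
Implicit Types (z w : R[i]) (t : R).
Local Notation Re := complex.Re.
Local Notation Im := complex.Im.

(** The hypotheses treat each rho separately and say nothing about the growth or sign of F at
    infinity, so no pointwise majorant is at hand: integrability at rho = 1/2 has to be transported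
    to every rho in ]0, 1[. In the variable u the integrand is free of rho and only the range of u
    depends on it. For small rho this range extends past the one for 1/2, but only where the
    argument 1 / u is small; this is why the values of F on [0, 6] are split off first. The number 6
    exceeds 16/3, which bounds rho / (t (1 - t)) for t in [1/4, 3/4].

    The formula for B in terms of Gamma is bypassed. Ratios of beta values come from integration by
    parts, and a zero of B would propagate to B(omega + n, w + n) for all n, against the
    concentration of (t (1 - t))^n at 1/2. For Gamma, the convergence of Gauss' product to a nonzero
    limit and the functional equation are established on Re z > 0; they turn the Pochhammer symbol
    into a finite product. *)

Lemma cReM z w : Re (z * w) = Re z * Re w - Im z * Im w.
Proof. by case: z; case: w. Qed.

Lemma cImM z w : Im (z * w) = Re z * Im w + Im z * Re w.
Proof. by case: z; case: w => a b c d /=; rewrite addrC. Qed.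

Lemma cReZ t z : Re (t%:C * z) = t * Re z.
Proof. by rewrite cReM /= mul0r subr0. Qed.

Lemma cImZ t z : Im (t%:C * z) = t * Im z.
Proof. by rewrite cImM /= mul0r addr0. Qed.

Lemma cReD z w : Re (z + w) = Re z + Re w.
Proof. by case: z; case: w. Qed.

Lemma cImD z w : Im (z + w) = Im z + Im w.
Proof. by case: z; case: w. Qed.

Lemma cReN z : Re (- z) = - Re z.
Proof. by case: z. Qed.

Lemma cImN z : Im (- z) = - Im z.
Proof. by case: z. Qed.

Lemma eqcP z w : Re z = Re w -> Im z = Im w -> z = w.
Proof. by case: z; case: w => a b c d /= -> ->. Qed.

Lemma Re_sum (u : nat -> R[i]) n : Re (\sum_(0 <= k < n) u k) = \sum_(0 <= k < n) Re (u k).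
Proof. by apply: (big_morph _ cReD). Qed.

Lemma Im_sum (u : nat -> R[i]) n : Im (\sum_(0 <= k < n) u k) = \sum_(0 <= k < n) Im (u k).
Proof. by apply: (big_morph _ cImD). Qed.

Lemma natC n : (n%:R : R[i]) = (n%:R : R)%:C.
Proof. by rewrite rmorph_nat. Qed.

Lemma normc_ge0 z : 0 <= Normc.normc z.
Proof. by case: z => a b; exact: sqrtr_ge0. Qed.

Lemma normRe_le z : `|Re z| <= Normc.normc z.
Proof. by case: z => a b /=; rewrite -sqrtr_sqr ler_wsqrtr// lerDl sqr_ge0. Qed.

Lemma normIm_le z : `|Im z| <= Normc.normc z.
Proof. by case: z => a b /=; rewrite -sqrtr_sqr ler_wsqrtr// lerDr sqr_ge0. Qed.

Lemma normc_le z : Normc.normc z <= `|Re z| + `|Im z|.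
Proof.
case: z => a b /=; rewrite -[leRHS]ger0_norm ?addr_ge0// -sqrtr_sqr ler_wsqrtr//.
by rewrite sqrrD !real_normK ?num_real// lerD2r lerDl mulrn_wge0// mulr_ge0.
Qed.

Lemma normcR t : Normc.normc t%:C = `|t|.
Proof. by rewrite /= expr0n addr0 sqrtr_sqr. Qed.

Lemma normcD z w : Normc.normc (z + w) <= Normc.normc z + Normc.normc w.
Proof. exact: le_normcD. Qed.

Lemma normc_gt0 z : z != 0 -> 0 < Normc.normc z.
Proof.
move=> z0; rewrite lt_neqAle normc_ge0 andbT eq_sym; apply: contra_neq z0.
exact: Normc.eq0_normc.
Qed.

Lemma cexpD z w : cexp (z + w) = cexp z * cexp w.
Proof.
case: z => a b; case: w => c d; apply: eqcP;
  rewrite /cexp ?cReZ ?cImZ ?cReM ?cImM ?cReZ ?cImZ /= expRD ?cosD ?sinD; ring.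
Qed.

Lemma normc_cexp z : Normc.normc (cexp z) = expR (Re z).
Proof.
by rewrite /cexp Normc.normcM normcR /= cos2Dsin2 sqrtr1 mulr1 ger0_norm// expR_ge0.
Qed.

Lemma cexp0 : cexp (0 : R[i]) = 1.
Proof. by rewrite /cexp /= expR0 cos0 sin0 mul1r. Qed.

Lemma cexp_real t : cexp t%:C = (expR t)%:C.
Proof. by rewrite /cexp /= cos0 sin0 mulr1. Qed.

Lemma Re_cpow t z : Re (cpow t z) = expR (Re z * ln t) * cos (Im z * ln t).
Proof. by rewrite /cpow /cexp cReZ cReM cImM /= !mulr0 subr0 add0r. Qed.

Lemma Im_cpow t z : Im (cpow t z) = expR (Re z * ln t) * sin (Im z * ln t).
Proof. by rewrite /cpow /cexp cImZ cReM cImM /= !mulr0 subr0 add0r. Qed.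

Lemma normc_cpow t z : 0 < t -> Normc.normc (cpow t z) = t `^ (Re z).
Proof.
by move=> t0; rewrite /cpow normc_cexp mulrC cReZ /powR gt_eqF// mulrC.
Qed.

Lemma cpowD t z w : cpow t (z + w) = cpow t z * cpow t w.
Proof. by rewrite /cpow mulrDl cexpD. Qed.

Lemma cpow_real t (a : R) : 0 < t -> cpow t a%:C = (t `^ a)%:C.
Proof. by move=> t0; rewrite /cpow -rmorphM cexp_real /powR gt_eqF. Qed.

Lemma cpow_nat t n : 0 < t -> cpow t n%:R = (t ^+ n)%:C.
Proof. by move=> t0; rewrite natC cpow_real// powR_mulrn// ltW. Qed.

Lemma cpow1 t : 0 < t -> cpow t 1 = t%:C.
Proof. by move=> t0; rewrite (cpow_nat 1 t0) expr1. Qed.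

Lemma cpow_neq0 t z : 0 < t -> cpow t z != 0.
Proof.
move=> t0; apply/eqP => E; have := normc_cpow z t0.
by rewrite E Normc.normc0 => /esym/eqP; rewrite gt_eqF// powR_gt0.
Qed.

Lemma cvg_complexP (u : nat -> R[i]^o) (l : R[i]) :
  (u n @[n --> \oo] --> (l : R[i]^o)) <->
  (Re (u n) @[n --> \oo] --> Re l) /\ (Im (u n) @[n --> \oo] --> Im l).
Proof.
split=> [/cvgrPdist_lt ul|[ul1 ul2]].
  by split; apply/cvgrPdist_lt => e e0;
    (have e0' : 0 < (e%:C : R[i]) by rewrite ltcR);
    move: (ul _ e0'); apply: filterS => n;
    rewrite normc_def ltcR -?cReN -?cImN -?cReD -?cImD;
    apply: le_lt_trans; rewrite -sqrtr_sqr ler_wsqrtr// ?lerDl ?lerDr sqr_ge0.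
(* The radius is a positive element of the complex field, hence real: its imaginary part is 0. *)
apply/cvgrPdist_lt => -[e b]; rewrite ltcE /= => /andP[/eqP -> e0].
move: ul1 ul2 => /cvgrPdist_lt ul1 /cvgrPdist_lt ul2.
have e2 : 0 < e / 2 by rewrite divr_gt0.
near=> n.
have -> : `|l - u n| = (Normc.normc (l - u n))%:C.
  by rewrite normc_def; case: (l - u n).
rewrite ltcR (le_lt_trans (normc_le _))// cReD cReN cImD cImN (splitr e) ltrD//; near: n.
- exact: ul1.
- exact: ul2.
Unshelve. all: by end_near. Qed.

Lemma limn_complex (u : nat -> R[i]^o) (l : R[i]) :
  u n @[n --> \oo] --> (l : R[i]^o) -> limn u = l.
Proof. by move=> ul; apply/cvg_lim => //; exact: norm_hausdorff. Qed.

Lemma cvg_complexM (u v : nat -> R[i]) (l m : R[i]) :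
  (u n : R[i]^o) @[n --> \oo] --> (l : R[i]^o) ->
  (v n : R[i]^o) @[n --> \oo] --> (m : R[i]^o) ->
  (u n * v n : R[i]^o) @[n --> \oo] --> (l * m : R[i]^o).
Proof.
move=> /cvg_complexP[u1 u2] /cvg_complexP[v1 v2]; apply/cvg_complexP; split.
  rewrite cReM (_ : (fun n => _) = fun n => Re (u n) * Re (v n) - Im (u n) * Im (v n)).
    by apply: cvgB; apply: cvgM.
  by apply/funext => n; exact: cReM.
rewrite cImM (_ : (fun n => _) = fun n => Re (u n) * Im (v n) + Im (u n) * Re (v n)).
  by apply: cvgD; apply: cvgM.
by apply/funext => n; exact: cImM.
Qed.

End ComplexBasics.

(** * Integrals of complex-valued functions over ]0, 1[ *)

Section ComplexIntegral.
Local Open Scope classical_set_scope.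
Context {R : realType}.
Local Notation Re := complex.Re.
Local Notation Im := complex.Im.
Local Notation normc := Normc.normc.
Local Notation mu := (@lebesgue_measure R).
Local Notation I01 := (`]0%R, 1%R[%classic : set R).

(** The domain is arbitrary because the square needs the same notion in [CFubini01]. *)
Definition cmeasurable d (T : measurableType d) (f : T -> R[i]) : Prop :=
  measurable_fun setT (fun t => Re (f t)) /\
  measurable_fun setT (fun t => Im (f t)).

Lemma cmeasurableM d (T : measurableType d) (f g : T -> R[i]) :
  cmeasurable f -> cmeasurable g -> cmeasurable (fun t => f t * g t).
Proof.
move=> [f1 f2] [g1 g2]; split.
  under eq_fun do rewrite cReM.
  by apply: measurable_funB; apply: measurable_funM.
under eq_fun do rewrite cImM.
by apply: measurable_funD; apply: measurable_funM.
Qed.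

Lemma cmeasurable_cst d (T : measurableType d) (c : R[i]) :
  cmeasurable (fun _ : T => c).
Proof. by split; exact: measurable_cst. Qed.

Lemma cmeasurable_real d (T : measurableType d) (f : T -> R) :
  measurable_fun setT f -> cmeasurable (fun t => (f t)%:C).
Proof. by move=> mf; split => //; exact: measurable_cst. Qed.

Lemma cmeasurable_cpow d (T : measurableType d) (f : T -> R) (z : R[i]) :
  measurable_fun setT f -> cmeasurable (fun t => cpow (f t) z).
Proof.
move=> mf; have mln : measurable_fun setT (fun t => ln (f t)).
  by apply: measurableT_comp mf; exact: measurable_ln.
have mcos : measurable_fun setT (@cos R).
  by apply: continuous_measurable_fun; exact: continuous_cos.
have msin : measurable_fun setT (@sin R).
  by apply: continuous_measurable_fun; exact: continuous_sin.
have mexp : measurable_fun setT (fun t => expR (Re z * ln (f t))).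
  by apply: measurableT_comp; [exact: measurable_expR|exact: measurable_funM].
split.
  under eq_fun do rewrite Re_cpow.
  by apply: measurable_funM => //; apply: measurableT_comp; [|exact: measurable_funM].
under eq_fun do rewrite Im_cpow.
by apply: measurable_funM => //; apply: measurableT_comp; [|exact: measurable_funM].
Qed.

Lemma cmeasurable_comp dd1 dd2 (T1 : measurableType dd1) (T2 : measurableType dd2)
  (f : T2 -> R[i]) (g : T1 -> T2) :
  cmeasurable f -> measurable_fun setT g -> cmeasurable (fun t => f (g t)).
Proof.
move=> [f1 f2] mg; split.
  exact: (measurableT_comp f1 mg).
exact: (measurableT_comp f2 mg).
Qed.

Lemma cmeasurable_sum (u : nat -> R -> R[i]) n : (forall k, cmeasurable (u k)) ->
  cmeasurable (fun t => \sum_(0 <= k < n) u k t).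
Proof.
move=> mu_; split.
  under eq_fun do rewrite Re_sum; apply: measurable_sum => k.
  by case: (mu_ k).
under eq_fun do rewrite Im_sum; apply: measurable_sum => k.
by case: (mu_ k).
Qed.

Lemma measurable_normc d (T : measurableType d) (f : T -> R[i]) :
  cmeasurable f -> measurable_fun setT (fun t => normc (f t)).
Proof.
move=> [f1 f2].
rewrite (_ : (fun t => _) = (fun t => (Re (f t) ^+ 2 + Im (f t) ^+ 2) `^ 2^-1)).
  apply: (@measurableT_comp _ _ _ _ _ _ (fun x => x `^ 2^-1)); first exact: measurable_powR.
  by apply: measurable_funD; apply: measurable_funX.
apply/funext => t; rewrite powR12_sqrt ?addr_ge0 ?sqr_ge0//.
by case: (f t).
Qed.

Lemma Cintegrable01_le (f : R -> R[i]) (g : R -> R) : cmeasurable f ->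
  mu.-integrable I01 (EFin \o g) ->
  (forall t, 0 < t < 1 -> normc (f t) <= g t) -> Cintegrable01 f.
Proof.
move=> [f1 f2] ig fg; split; apply: le_integrable ig => //.
- by apply/measurable_EFinP; exact: measurable_funTS.
- move=> t /=; rewrite in_itv /= => /fg fgt; rewrite lee_fin.
  by rewrite (le_trans (normRe_le _))// (le_trans fgt)// ler_norm.
- by apply/measurable_EFinP; exact: measurable_funTS.
- move=> t /=; rewrite in_itv /= => /fg fgt; rewrite lee_fin.
  by rewrite (le_trans (normIm_le _))// (le_trans fgt)// ler_norm.
Qed.

Lemma eq_Cintegrable01 (f g : R -> R[i]) : (forall t, 0 < t < 1 -> f t = g t) ->
  Cintegrable01 f -> Cintegrable01 g.
Proof.
move=> fg [f1 f2]; split; [apply: eq_integrable f1|apply: eq_integrable f2] => //;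
by move=> t; rewrite inE /= in_itv /= => /fg ->.
Qed.

Lemma eq_Cintegral01 (f g : R -> R[i]) : (forall t, 0 < t < 1 -> f t = g t) ->
  Cintegral01 f = Cintegral01 g.
Proof.
move=> fg; congr (_ +i* _); apply: eq_Rintegral => t; rewrite inE /= in_itv /=;
by move=> /fg ->.
Qed.

Lemma Cintegrable01_norm (f : R -> R[i]) : cmeasurable f -> Cintegrable01 f ->
  mu.-integrable I01 (EFin \o (fun t => normc (f t))).
Proof.
move=> mf [f1 f2].
have ig := @integrableD _ _ _ mu I01 (measurable_itv _) _ _ (integrable_abse f1) (integrable_abse f2).
apply: le_integrable ig => //.
  by apply/measurable_EFinP; apply: measurable_funTS; exact: measurable_normc.
move=> t _ /=; rewrite lee_fin ger0_norm ?normc_ge0//.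
by rewrite (le_trans (normc_le _))// ler_norm.
Qed.

Lemma Cintegrable01D (f g : R -> R[i]) : Cintegrable01 f -> Cintegrable01 g ->
  Cintegrable01 (fun t => f t + g t).
Proof.
move=> [f1 f2] [g1 g2]; split.
  have := @integrableD _ _ _ mu I01 (measurable_itv _) _ _ f1 g1.
  by apply: eq_integrable => // t _ /=; rewrite cReD.
have := @integrableD _ _ _ mu I01 (measurable_itv _) _ _ f2 g2.
by apply: eq_integrable => // t _ /=; rewrite cImD.
Qed.

Lemma Cintegral01D (f g : R -> R[i]) : Cintegrable01 f -> Cintegrable01 g ->
  Cintegral01 (fun t => f t + g t) = Cintegral01 f + Cintegral01 g.
Proof.
move=> [f1 f2] [g1 g2]; apply: eqcP; rewrite ?cReD ?cImD /=.
  by rewrite -RintegralD//; apply: eq_Rintegral => t _; rewrite cReD.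
by rewrite -RintegralD//; apply: eq_Rintegral => t _; rewrite cImD.
Qed.

Lemma Cintegrable01Z (c : R[i]) (f : R -> R[i]) : Cintegrable01 f ->
  Cintegrable01 (fun t => c * f t).
Proof.
move=> [f1 f2]; split.
  have := @integrableB _ _ _ mu I01 (measurable_itv _) _ _ (@integrableZl _ _ _ mu I01 (measurable_itv _) (Re c) _ f1)
   (@integrableZl _ _ _ mu I01 (measurable_itv _) (Im c) _ f2).
  by apply: eq_integrable => // t _ /=; rewrite cReM EFinB !EFinM.
have := @integrableD _ _ _ mu I01 (measurable_itv _) _ _ (@integrableZl _ _ _ mu I01 (measurable_itv _) (Re c) _ f2)
   (@integrableZl _ _ _ mu I01 (measurable_itv _) (Im c) _ f1).
by apply: eq_integrable => // t _ /=; rewrite cImM EFinD !EFinM.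
Qed.

Lemma RintegralZ_EFin (c : R) (f : R -> R) : mu.-integrable I01 (EFin \o f) ->
  mu.-integrable I01 (EFin \o (fun t => c * f t)).
Proof. by move=> /(@integrableZl _ _ _ mu I01 (measurable_itv _) c _); apply: eq_integrable. Qed.

Lemma Cintegral01Z (c : R[i]) (f : R -> R[i]) : Cintegrable01 f ->
  Cintegral01 (fun t => c * f t) = c * Cintegral01 f.
Proof.
move=> [f1 f2]; apply: eqcP; rewrite ?cReM ?cImM /=.
  rewrite -!RintegralZl//= -RintegralB//; try exact: RintegralZ_EFin.
  by apply: eq_Rintegral => t _; rewrite cReM.
rewrite -!RintegralZl//= -RintegralD//; try exact: RintegralZ_EFin.
by apply: eq_Rintegral => t _; rewrite cImM.
Qed.

Lemma Cintegrable01_0 : Cintegrable01 (fun _ => 0 : R[i]).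
Proof. by split; exact: integrable0. Qed.

Lemma Cintegral01_0 : Cintegral01 (fun _ => 0 : R[i]) = 0.
Proof. by apply: eqcP => /=; rewrite Rintegral_cst//= mul0r. Qed.

Lemma Cintegral01_sum (u : nat -> R -> R[i]) n :
  (forall k, Cintegrable01 (u k)) ->
  Cintegrable01 (fun t => \sum_(0 <= k < n) u k t) /\
  Cintegral01 (fun t => \sum_(0 <= k < n) u k t) =
  \sum_(0 <= k < n) Cintegral01 (u k).
Proof.
move=> iu; elim: n => [|n [IH1 IH2]].
  rewrite big_geq//; split.
    by apply: eq_Cintegrable01 Cintegrable01_0 => t _; rewrite big_geq.
  by apply: etrans Cintegral01_0; apply: eq_Cintegral01 => t _; rewrite big_geq.
rewrite big_nat_recr//= -IH2 -Cintegral01D//; split.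
  by apply: eq_Cintegrable01 (Cintegrable01D IH1 (iu n)) => t _; rewrite big_nat_recr.
by apply: eq_Cintegral01 => t _; rewrite big_nat_recr.
Qed.

Lemma Rdominated_cvg d (T : measurableType d) (nu : {measure set T -> \bar R})
    (D : set T) (f_ : nat -> T -> R) (f g : T -> R) : measurable D ->
  (forall n, measurable_fun D (f_ n)) ->
  (forall t, D t -> f_ n t @[n --> \oo] --> f t) ->
  nu.-integrable D (EFin \o g) ->
  (forall n t, D t -> `|f_ n t| <= g t) ->
  nu.-integrable D (EFin \o f) /\
  \int[nu]_(t in D) f_ n t @[n --> \oo] --> \int[nu]_(t in D) f t.
Proof.
move=> mD mf ff ig fg.
have mE n : measurable_fun D (EFin \o f_ n) by apply/measurable_EFinP.
have ffE t : D t -> (EFin \o f_ n) t @[n --> \oo] --> (EFin \o f) t.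
  by move=> /ff ft; apply: cvg_EFin ft; exact: nearW.
have fgE n t : D t -> (`|(EFin \o f_ n) t| <= (EFin \o g) t)%E.
  by move=> Dt; rewrite lee_fin; exact: fg.
have mfl : measurable_fun D (EFin \o f) by apply: emeasurable_fun_cvg ffE.
have ae1 : {ae nu, forall t, D t -> (EFin \o f_ n) t @[n --> \oo] --> (EFin \o f) t}.
  exact: aeW.
have ae2 : {ae nu, forall t n, D t -> (`|(EFin \o f_ n) t| <= (EFin \o g) t)%E}.
  by apply: aeW => t n; exact: fgE.
have [ifl _ cv] := dominated_convergence mD mE mfl ae1 ig ae2.
split => //; apply: fine_cvg; rewrite fineK//.
exact: integrable_fin_num.
Qed.

Lemma Cdominated_cvg (f_ : nat -> R -> R[i]) (f : R -> R[i]) (g : R -> R) :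
  (forall n, cmeasurable (f_ n)) ->
  (forall t, 0 < t < 1 -> (f_ n t : R[i]^o) @[n --> \oo] --> (f t : R[i]^o)) ->
  mu.-integrable I01 (EFin \o g) ->
  (forall n t, 0 < t < 1 -> normc (f_ n t) <= g t) ->
  Cintegrable01 f /\
  (Cintegral01 (f_ n) : R[i]^o) @[n --> \oo] --> (Cintegral01 f : R[i]^o).
Proof.
move=> mf ff ig fg.
have [|t||n t|i1 c1] := @Rdominated_cvg _ _ mu I01 (fun n t => Re (f_ n t)) (fun t => Re (f t)) g (measurable_itv _).
- by move=> n; apply: measurable_funTS; case: (mf n).
- by rewrite /= in_itv /= => /ff /cvg_complexP[].
- exact: ig.
- by rewrite /= in_itv /= => h; apply: le_trans (fg n t h); exact: normRe_le.
have [|t||n t|i2 c2] := @Rdominated_cvg _ _ mu I01 (fun n t => Im (f_ n t)) (fun t => Im (f t)) g (measurable_itv _).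
- by move=> n; apply: measurable_funTS; case: (mf n).
- by rewrite /= in_itv /= => /ff /cvg_complexP[].
- exact: ig.
- by rewrite /= in_itv /= => h; apply: le_trans (fg n t h); exact: normIm_le.
by split => //; apply/cvg_complexP.
Qed.

End ComplexIntegral.

(** * Exhaustion of ]0, 1[ and the real beta weight *)

Section Exhaustion.
Local Open Scope classical_set_scope.
Context {R : realType}.
Local Notation mu := (@lebesgue_measure R).
Local Notation I01 := (`]0%R, 1%R[%classic : set R).

Lemma in01 t : I01 t -> 0 < t < 1.
Proof. by rewrite /= in_itv. Qed.

(** The shift by 3 keeps 1 / (n + 3) strictly below 1/2, so that no interval is degenerate. *)
Definition exhaust01 (n : nat) : set R := `[n.+3%:R^-1, 1 - n.+3%:R^-1]%classic.

Lemma invn3_itv n : (0 : R) < n.+3%:R^-1 < (2^-1 : R).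
Proof. by rewrite invr_gt0 ltr0n /= ltf_pV2 ?posrE ?ltr0n// ltr_nat. Qed.

Lemma exhaust01_sub n : exhaust01 n `<=` I01.
Proof.
have /andP[n0 n2] := invn3_itv n.
move=> t; rewrite /exhaust01 /= !in_itv /= => /andP[t1 t2].
by move: n0 n2 t1 t2; set e := _^-1 => *; apply/andP; split; lra.
Qed.

Lemma exhaust01_homo m n : (m <= n)%N -> exhaust01 m `<=` exhaust01 n.
Proof.
move=> mn t; rewrite /exhaust01 /= !in_itv /= => /andP[t1 t2].
have : n.+3%:R^-1 <= m.+3%:R^-1 :> R by rewrite lef_pV2 ?posrE ?ltr0n// ler_nat.
by move: t1 t2; set d := m.+3%:R^-1; set e := _^-1 => *; apply/andP; split; lra.
Qed.

Lemma exhaust01_near t : I01 t -> \forall n \near \oo, exhaust01 n t.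
Proof.
rewrite /= in_itv /= => /andP[t0 t1].
have e0 : 0 < Num.min t (1 - t) by rewrite lt_min t0 subr_gt0.
have := near_infty_natSinv_lt (PosNum e0); apply: filterS => n /=.
have le : n.+3%:R^-1 <= n.+1%:R^-1 :> R by rewrite lef_pV2 ?posrE ?ltr0n// ler_nat leqW.
rewrite lt_min => /andP[h1 h2]; rewrite /exhaust01 /= in_itv /=.
by move: le h1 h2; set d := n.+3%:R^-1; set e := _^-1 => *; apply/andP; split; lra.
Qed.

Lemma integral_exhaust01 n (f : R -> \bar R) :
  (\int[mu]_(t in exhaust01 n) f t = \int[mu]_(t in I01) (f \_ (exhaust01 n)) t)%E.
Proof. by rewrite -integral_mkcondr setIidr//; exact: exhaust01_sub. Qed.

(** Monotone convergence. Bounds can thus be proved on compact intervals, where the fundamental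
    theorem of calculus and substitution apply, and then carried over to ]0, 1[. *)
Lemma integral_exhaust01_le (g : R -> R) (C : R) :
  measurable_fun setT g -> (forall t, I01 t -> 0 <= g t) ->
  (forall n, (\int[mu]_(t in exhaust01 n) (g t)%:E <= C%:E)%E) ->
  (\int[mu]_(t in I01) (g t)%:E <= C%:E)%E.
Proof.
move=> mg g0 gC; pose h n : R -> \bar R := (EFin \o g) \_ (exhaust01 n).
have mh n : measurable_fun I01 (h n).
  apply/measurable_restrict => //; first exact: measurable_itv.
  apply: measurable_funTS.
  exact/measurable_EFinP.
have h0 n t : I01 t -> (0 <= h n t)%E.
  by move=> It; rewrite /h patchE; case: ifP => // _; rewrite lee_fin g0.
have hh t : I01 t -> {homo h^~ t : n m / (n <= m)%N >-> (n <= m)%E}.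
  move=> It m n mn; rewrite /h !patchE; case: ifP => [tm|_].
    by rewrite mem_set//; apply: exhaust01_homo mn _ _; rewrite inE in tm.
  by case: ifP => // _; rewrite lee_fin g0.
have := @cvg_monotone_convergence _ _ _ mu I01 (measurable_itv _) h mh h0 hh.
have -> : (\int[mu]_(x in I01) limn (h^~ x) = \int[mu]_(t in I01) (g t)%:E)%E.
  apply: eq_integral => t; rewrite inE => /exhaust01_near tn.
  apply/cvg_lim => //; apply: cvg_near_cst; apply: filterS tn => n tn.
  by rewrite /h patchE mem_set.
move=> cv; rewrite -(cvg_lim _ cv)//; apply: lime_le.
  by apply/cvg_ex; eexists; exact: cv.
by apply: nearW => n; rewrite -integral_exhaust01.
Qed.

Lemma Rintegral_exhaust01_cvg (g : R -> R) : mu.-integrable I01 (EFin \o g) ->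
  \int[mu]_(t in exhaust01 n) g t @[n --> \oo] --> \int[mu]_(t in I01) g t.
Proof.
move=> ig.
have mg : measurable_fun I01 g by apply/measurable_EFinP; exact: measurable_int ig.
rewrite (_ : (fun n => _) = fun n => \int[mu]_(t in I01) (g \_ (exhaust01 n)) t); last first.
  by apply/funext => n; rewrite -Rintegral_mkcondr setIidr//; exact: exhaust01_sub.
have [|||n t It|//] := @Rdominated_cvg _ _ _ mu I01 (fun n => g \_ (exhaust01 n)) g (fun t => `|g t|) (measurable_itv _).
- move=> n; apply/measurable_restrict => //; first exact: measurable_itv.
  by apply: measurable_funS mg => //; exact: subIsetl.
- move=> t It; apply: cvg_near_cst; apply: filterS (exhaust01_near It) => n tn.
  by rewrite patchE mem_set.
- exact: integrable_abse ig.
- by rewrite patchE; case: ifP => //; rewrite normr0.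
Qed.

End Exhaustion.

(** * Integrability of the real beta weight *)

Section RealBeta.
Local Open Scope classical_set_scope.
Context {R : realType}.
Local Notation mu := (@lebesgue_measure R).
Local Notation I01 := (`]0%R, 1%R[%classic : set R).

Lemma ge0_integrable_le (D : set R) (g : R -> R) (C : R) : measurable_fun D g ->
  (forall t, D t -> 0 <= g t) ->
  (\int[mu]_(t in D) (g t)%:E <= C%:E)%E -> mu.-integrable D (EFin \o g).
Proof.
move=> mg g0 gC; apply/integrableP; split; first exact/measurable_EFinP.
apply: le_lt_trans (ltry C); apply: le_trans gC.
rewrite le_eqVlt; apply/orP; left; apply/eqP; apply: eq_integral => t.
by rewrite inE => /g0 gt0 /=; rewrite ger0_norm.
Qed.

Lemma is_derive1_continuous (f : R -> R) (t df : R) :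
  is_derive t 1 f df -> {for t, continuous f}.
Proof. by move=> ft; apply/differentiable_continuous/derivable1_diffP. Qed.

Lemma continuous_within (f : R -> R) (a b : R) :
  (forall t, a <= t <= b -> {for t, continuous f}) -> {within `[a, b], continuous f}.
Proof.
move=> cf; apply: continuous_in_subspaceT => t.
by rewrite inE /= in_itv /= => /cf.
Qed.

Lemma continuous_FTC2_closed (f F : R -> R) (a b : R) : a < b ->
  (forall t, a <= t <= b -> {for t, continuous f}) ->
  (forall t, a <= t <= b -> is_derive t 1 F (f t)) ->
  (\int[mu]_(t in `[a, b]) (f t)%:E = (F b - F a)%:E)%E.
Proof.
move=> ab cf dF.
have cF t : a <= t <= b -> {for t, continuous F}.
  by move=> /dF; exact: is_derive1_continuous.
rewrite (@continuous_FTC2 _ _ F)//.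
- exact: continuous_within.
- split.
  + by move=> t; rewrite in_itv /= => /andP[/ltW ta /ltW tb]; have := dF t; rewrite ta tb => /(_ erefl) [].
  + by apply: cvg_at_right_filter; apply: cF; rewrite lexx ltW.
  + by apply: cvg_at_left_filter; apply: cF; rewrite lexx ltW.
- move=> t; rewrite in_itv /= => /andP[/ltW ta /ltW tb].
  by have := dF t; rewrite ta tb => /(_ erefl) [_ <-]; rewrite derive1E.
Qed.

Lemma is_derive_onem (t : R) : is_derive t 1 (fun x : R => 1 - x) (- 1).
Proof.
apply: is_derive_eq (is_deriveB (is_derive_cst (1 : R) t 1) (is_derive_id t 1)) _.
by rewrite sub0r.
Qed.

Lemma is_derive_onem_powR (b t : R) : 0 < 1 - t ->
  is_derive t 1 (fun x : R => (1 - x) `^ b) (- (b * (1 - t) `^ (b - 1))).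
Proof.
move=> t1.
have := @is_derive1_comp _ (fun x => x `^ b) (fun x => 1 - x) _ _ _ (is_derive1_powR b t1) (is_derive_onem t).
by rewrite mulrN1.
Qed.

Definition beta_weight (a b t : R) : R := t `^ (a - 1) * (1 - t) `^ (b - 1).

Lemma beta_weight_ge0 a b t : 0 <= beta_weight a b t.
Proof. by rewrite mulr_ge0// powR_ge0. Qed.

Lemma measurable_beta_weight a b : measurable_fun setT (beta_weight a b).
Proof.
apply: measurable_funM; first exact: measurable_powR.
apply: (@measurableT_comp _ _ _ _ _ _ (fun x => x `^ (b - 1))); first exact: measurable_powR.
exact: measurable_funB.
Qed.

(** One of t and 1 - t is at least 1/2, and a number in [1/2, 1] raised to an exponent above -1 is
    at most 2. *)
Lemma beta_weight_le a b t : 0 < a -> 0 < b -> 0 < t < 1 ->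
  beta_weight a b t <= 2 * (t `^ (a - 1) + (1 - t) `^ (b - 1)).
Proof.
move=> a0 b0 /andP[t0 t1].
have half (s c : R) : 0 < c -> 2^-1 <= s <= 1 -> s `^ (c - 1) <= 2.
  move=> c0 /andP[s2 s1]; have s0 : 0 < s by lra.
  apply: (@le_trans _ _ (s `^ (- 1))).
    by apply: ger_powR; [rewrite s0 s1|lra].
  by rewrite (powR_inv1 (ltW s0)) invf_ple ?posrE.
have p1 := powR_ge0 t (a - 1); have p2 := powR_ge0 (1 - t) (b - 1).
rewrite /beta_weight; have [t2|t2] := leP t 2^-1.
  have h : (1 - t) `^ (b - 1) <= 2 by apply: half => //; apply/andP; split; lra.
  by nra.
have h : t `^ (a - 1) <= 2 by apply: half => //; apply/andP; split; lra.
by nra.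
Qed.

Lemma beta_weight_integrable a b : 0 < a -> 0 < b ->
  mu.-integrable I01 (EFin \o beta_weight a b).
Proof.
move=> a0 b0.
suff : mu.-integrable I01 (EFin \o (fun t => t `^ (a - 1) + (1 - t) `^ (b - 1))).
  move=> /(@integrableZl _ _ _ mu I01 (measurable_itv _) 2 _).
  apply: le_integrable => //.
    by apply/measurable_EFinP/measurable_funTS; exact: measurable_beta_weight.
  move=> t /=; rewrite in_itv /= => t01; rewrite lee_fin ger0_norm ?beta_weight_ge0//.
  rewrite (le_trans (beta_weight_le a0 b0 t01))// ler_norm//.
have mg : measurable_fun setT (fun t : R => t `^ (a - 1) + (1 - t) `^ (b - 1)).
  apply: measurable_funD; first exact: measurable_powR.
  apply: (@measurableT_comp _ _ _ _ _ _ (fun x => x `^ (b - 1))); first exact: measurable_powR.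
  exact: measurable_funB.
apply: (@ge0_integrable_le _ _ (a^-1 + b^-1)); first exact: measurable_funTS.
  by move=> t _; rewrite addr_ge0 ?powR_ge0.
apply: integral_exhaust01_le => //.
  by move=> t _; rewrite addr_ge0 ?powR_ge0.
move=> n; have /andP[n0 n2] := invn3_itv n (R := R).
rewrite /exhaust01; move: n0 n2; set e : R := n.+3%:R^-1 => n0 n2.
have pos t : e <= t <= 1 - e -> 0 < t /\ 0 < 1 - t by move=> /andP[t1 t2]; split; lra.
(* An antiderivative of the sum of the two powers. All powers in its end point values lie in [0, 1],
   whence the bound 1/a + 1/b. *)
pose F (t : R) := a^-1 * t `^ a - b^-1 * (1 - t) `^ b.
have -> : (\int[mu]_(t in `[e, (1 - e)%R]) (t `^ (a - 1) + (1 - t) `^ (b - 1))%:E = (F (1 - e) - F e)%:E)%E; last first.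
- rewrite lee_fin; have p0 (s c : R) : 0 < c -> 0 < s < 1 -> 0 <= c^-1 * s `^ c <= c^-1.
    move=> c0 /andP[s0 s1]; rewrite mulr_ge0 ?powR_ge0 ?invr_ge0 ?(ltW c0)//=.
    rewrite ler_piMr ?invr_ge0 ?(ltW c0)//.
    apply: (@le_trans _ _ (1 `^ c)); last by rewrite powR1.
    by apply: ge0_ler_powR; rewrite ?nnegrE ?ltW.
  have /andP[q1 q2] : 0 <= a^-1 * (1 - e) `^ a <= a^-1 by apply: p0 => //; lra.
  have /andP[q3 q4] : 0 <= b^-1 * (1 - (1 - e)) `^ b <= b^-1 by apply: p0 => //; lra.
  have /andP[q5 q6] : 0 <= a^-1 * e `^ a <= a^-1 by apply: p0 => //; lra.
  have /andP[q7 q8] : 0 <= b^-1 * (1 - e) `^ b <= b^-1 by apply: p0 => //; lra.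
  rewrite /F; lra.
apply: continuous_FTC2_closed.
- lra.
- move=> t /pos [t0 t1].
  have c1 : {for t, continuous (fun x : R => x `^ (a - 1))}.
    exact: is_derive1_continuous (is_derive1_powR _ t0).
  have c2 : {for t, continuous (fun x : R => (1 - x) `^ (b - 1))}.
    exact: is_derive1_continuous (is_derive_onem_powR _ t1).
  exact: cvgD c1 c2.
- move=> t /pos [t0 t1].
  have d1 := is_derive1_powR a t0.
  have d2 := is_derive_onem_powR b t1.
  apply: is_derive_eq (is_deriveB (is_deriveZ a^-1 d1) (is_deriveZ b^-1 d2)) _.
  rewrite /GRing.scale /= mulrN opprK !mulrA !mulVf ?mul1r ?gt_eqF//.
Qed.

End RealBeta.

(** * The complex beta function *)

Section ComplexBeta.
Local Open Scope classical_set_scope.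
Context {R : realType}.
Local Notation Re := complex.Re.
Local Notation Im := complex.Im.
Local Notation normc := Normc.normc.
Local Notation mu := (@lebesgue_measure R).
Local Notation I01 := (`]0%R, 1%R[%classic : set R).
Implicit Types (t : R) (z v omega w : R[i]).

Definition is_cderive t (f : R -> R[i]) (df : R[i]) : Prop :=
  is_derive t 1 (fun x => Re (f x)) (Re df) /\
  is_derive t 1 (fun x => Im (f x)) (Im df).

Lemma is_cderiveM t (f g : R -> R[i]) (df dg : R[i]) :
  is_cderive t f df -> is_cderive t g dg ->
  is_cderive t (fun x => f x * g x) (df * g t + f t * dg).
Proof.
move=> [f1 f2] [g1 g2]; split.
  rewrite (_ : (fun x => _) = (fun x => Re (f x)) * (fun x => Re (g x)) -
     (fun x => Im (f x)) * (fun x => Im (g x))); last first.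
    by apply/funext => x; rewrite cReM.
  apply: is_derive_eq (is_deriveB (is_deriveM f1 g1) (is_deriveM f2 g2)) _.
  rewrite /GRing.scale /= cReD !cReM; ring.
rewrite (_ : (fun x => _) = (fun x => Re (f x)) * (fun x => Im (g x)) +
   (fun x => Im (f x)) * (fun x => Re (g x))); last first.
  by apply/funext => x; rewrite cImM.
apply: is_derive_eq (is_deriveD (is_deriveM f1 g2) (is_deriveM f2 g1)) _.
rewrite /GRing.scale /= cImD !cImM; ring.
Qed.

Lemma is_cderive_cst t (c : R[i]) : is_cderive t (fun=> c) 0.
Proof. by split; exact: is_derive_cst. Qed.

Lemma is_cderive_comp t (f : R -> R[i]) (g : R -> R) (df : R[i]) (dg : R) :
  is_cderive (g t) f df -> is_derive t 1 g dg ->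
  is_cderive t (fun x => f (g x)) (dg%:C * df).
Proof.
move=> [f1 f2] dgt; split; rewrite ?cReZ ?cImZ mulrC.
  exact: (@is_derive1_comp _ (fun x => Re (f x)) g).
exact: (@is_derive1_comp _ (fun x => Im (f x)) g).
Qed.

Lemma cpow_subr1 t z : 0 < t -> cpow t (z - 1) = t^-1%:C * cpow t z.
Proof.
move=> t0; rewrite -{2}[z](subrK 1) (cpowD _ (z - 1) 1) cpow1// mulrCA -rmorphM.
by rewrite mulVf ?gt_eqF// mulr1.
Qed.

Lemma cpow_addr1 t z : 0 < t -> cpow t (z + 1) = t%:C * cpow t z.
Proof. by move=> t0; rewrite cpowD cpow1// mulrC. Qed.

Lemma is_cderive_cpow t z : 0 < t ->
  is_cderive t (fun x => cpow x z) (z * cpow t (z - 1)).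
Proof.
move=> t0; have dln := is_derive1_ln t0.
have dexp := @is_derive1_comp _ expR (fun x => Re z * ln x) _ _ _
  (is_derive_expR _) (is_deriveZ (Re z) dln).
have dcos := @is_derive1_comp _ cos (fun x => Im z * ln x) _ _ _
  (is_derive_cos _) (is_deriveZ (Im z) dln).
have dsin := @is_derive1_comp _ sin (fun x => Im z * ln x) _ _ _
  (is_derive_sin _) (is_deriveZ (Im z) dln).
rewrite cpow_subr1//; split.
  under eq_fun do rewrite Re_cpow.
  apply: is_derive_eq (is_deriveM dexp dcos) _.
  rewrite cReM cReZ cImZ Re_cpow Im_cpow /GRing.scale /=; ring.
under eq_fun do rewrite Im_cpow.
apply: is_derive_eq (is_deriveM dexp dsin) _.
rewrite cImM cReZ cImZ Re_cpow Im_cpow /GRing.scale /=; ring.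
Qed.

Definition beta_kernel omega w t : R[i] := cpow t (omega - 1) * cpow (1 - t) (w - 1).

Lemma cBetaE omega w : cBeta omega w = Cintegral01 (beta_kernel omega w).
Proof. by []. Qed.

Lemma cmeasurable_beta_kernel omega w : cmeasurable (beta_kernel omega w).
Proof.
by apply: cmeasurableM; apply: cmeasurable_cpow => //; exact: measurable_funB.
Qed.

Lemma normc_beta_kernel omega w t : 0 < t < 1 ->
  normc (beta_kernel omega w t) = beta_weight (Re omega) (Re w) t.
Proof.
move=> /andP[t0 t1]; rewrite Normc.normcM !normc_cpow ?subr_gt0// !cReD !cReN.
by [].
Qed.

Lemma beta_kernel_integrable omega w : 0 < Re omega -> 0 < Re w ->
  Cintegrable01 (beta_kernel omega w).
Proof.
move=> o0 w0; apply: Cintegrable01_le (beta_weight_integrable o0 w0) _.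
  exact: cmeasurable_beta_kernel.
by move=> t t01; rewrite normc_beta_kernel.
Qed.

(** The kernel with both parameters raised is t^omega (1 - t)^w, which tends to 0 at both ends; its
    derivative carries the integration by parts in [cBeta_parts]. *)
Lemma is_cderive_beta_kernel omega w t : 0 < t < 1 ->
  is_cderive t (beta_kernel (omega + 1) (w + 1))
    (omega * beta_kernel omega (w + 1) t - w * beta_kernel (omega + 1) w t).
Proof.
move=> /andP[t0 t1]; have t1' : 0 < 1 - t by rewrite subr_gt0.
rewrite /beta_kernel !addrK.
have dk := is_cderiveM (is_cderive_cpow omega t0)
   (@is_cderive_comp t (fun x => cpow x w) (fun x => 1 - x) _ _ (is_cderive_cpow w t1') (is_derive_onem t)).
rewrite rmorphN1 in dk; congr is_cderive: dk; ring.
Qed.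

(** Every kernel is the raised kernel of the parameters lowered by 1, so it is differentiable by the
    previous formula. *)
Lemma beta_kernel_continuous omega w t : 0 < t < 1 ->
  {for t, continuous (fun x => Re (beta_kernel omega w x))} /\
  {for t, continuous (fun x => Im (beta_kernel omega w x))}.
Proof.
move=> t01; rewrite -[omega](subrK 1) -[w](subrK 1).
have [d1 d2] := is_cderive_beta_kernel (omega - 1) (w - 1) t01.
by split; [exact: is_derive1_continuous d1|exact: is_derive1_continuous d2].
Qed.

Lemma exhaust01_cvg (a : R) : 0 < a -> (n.+3%:R^-1 : R) `^ a @[n --> \oo] --> (0 : R).
Proof.
move=> a0; have /cvg_at_rightP := powR_cvg0 a0; apply; split.
  by move=> n; rewrite invr_gt0.
have : (fun n => n.+1%:R^-1 : R) n @[n --> \oo] --> (0 : R) by exact: cvg_harmonic.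
by rewrite -(cvg_shiftn 2); under eq_fun do rewrite addn2.
Qed.

(** The fundamental theorem of calculus on the exhausting intervals. The boundary values enter as
    limits along these intervals because F need not behave at 0 and 1 themselves. *)
Lemma Cintegral01_derive (F f : R -> R[i]) :
  (forall t, 0 < t < 1 -> is_cderive t F (f t)) ->
  (forall t, 0 < t < 1 -> {for t, continuous (fun x => Re (f x))}) ->
  (forall t, 0 < t < 1 -> {for t, continuous (fun x => Im (f x))}) ->
  Cintegrable01 f ->
  (F (1 - n.+3%:R^-1) : R[i]^o) @[n --> \oo] --> (0 : R[i]^o) ->
  (F (n.+3%:R^-1) : R[i]^o) @[n --> \oo] --> (0 : R[i]^o) ->
  Cintegral01 f = 0.
Proof.
move=> dF c1 c2 [i1 i2] /cvg_complexP[F1 F2] /cvg_complexP[F3 F4].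
have key (g G : R -> R) : (forall t, 0 < t < 1 -> is_derive t 1 G (g t)) ->
   (forall t, 0 < t < 1 -> {for t, continuous g}) ->
   mu.-integrable I01 (EFin \o g) ->
   G (1 - n.+3%:R^-1) @[n --> \oo] --> (0 : R) ->
   G (n.+3%:R^-1) @[n --> \oo] --> (0 : R) -> \int[mu]_(t in I01) g t = 0.
  move=> dG cg ig G1 G2; have := Rintegral_exhaust01_cvg ig.
  rewrite (_ : (fun n => _) = (fun n => G (1 - n.+3%:R^-1) - G (n.+3%:R^-1))).
    move=> cv; rewrite -(cvg_lim _ cv)//; apply/cvg_lim => //.
    by rewrite -[X in _ --> X](subrr (0 : R)); exact: cvgB.
  apply/funext => n; have /andP[] := @invn3_itv R n; set e : R := n.+3%:R^-1 => n0 n2.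
  have e01 t : e <= t <= 1 - e -> 0 < t < 1 by move=> /andP[? ?]; apply/andP; split; lra.
  have -> : \int[mu]_(t in exhaust01 n) g t = fine (G (1 - e) - G e)%:E; last by [].
  congr fine; apply: continuous_FTC2_closed; first by rewrite -/e; lra.
    by move=> t /e01; exact: cg.
  by move=> t /e01; exact: dG.
apply: eqcP => /=.
  by apply: (key _ (fun x => Re (F x)) _ c1 i1 F1 F3) => t /dF[].
by apply: (key _ (fun x => Im (F x)) _ c2 i2 F2 F4) => t /dF[].
Qed.

Lemma beta_kernel_cvg0 omega w : 0 < Re omega -> 0 < Re w ->
  (beta_kernel (omega + 1) (w + 1) (1 - n.+3%:R^-1) : R[i]^o) @[n --> \oo] --> (0 : R[i]^o) /\
  (beta_kernel (omega + 1) (w + 1) (n.+3%:R^-1) : R[i]^o) @[n --> \oo] --> (0 : R[i]^o).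
Proof.
move=> o0 w0.
have le1 (s c : R) : 0 < c -> 0 < s < 1 -> s `^ c <= 1.
  move=> c0 /andP[s0 s1]; apply: (@le_trans _ _ (1 `^ c)); last by rewrite powR1.
  by apply: ge0_ler_powR; rewrite ?nnegrE ?ltW.
have bound t : 0 < t < 1 ->
   normc (beta_kernel (omega + 1) (w + 1) t) = t `^ Re omega * (1 - t) `^ Re w.
  by move=> t01; rewrite normc_beta_kernel// /beta_weight !cReD /= !addrK.
have sq (u : nat -> R[i]^o) (v : nat -> R) : (forall n, normc (u n) <= v n) ->
    v n @[n --> \oo] --> (0 : R) -> u n @[n --> \oo] --> (0 : R[i]^o).
  move=> uv v0; apply/cvg_complexP; split; apply/norm_cvg0P;
    apply: (@squeeze_cvgr _ _ _ _ (fun=> 0) v) => //; try exact: cvg_cst;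
    apply: nearW => n; rewrite normr_ge0 (le_trans _ (uv n))//;
    [exact: normRe_le|exact: normIm_le].
split.
  apply: sq (exhaust01_cvg w0) => n; have /andP[] := @invn3_itv R n.
  set e : R := n.+3%:R^-1 => n0 n2; rewrite bound; last by apply/andP; split; lra.
  rewrite (_ : 1 - (1 - e) = e); last lra.
  rewrite ler_piMl ?powR_ge0//; apply: le1 => //; apply/andP; split; lra.
apply: sq (exhaust01_cvg o0) => n; have /andP[] := @invn3_itv R n.
set e : R := n.+3%:R^-1 => n0 n2; rewrite bound; last by apply/andP; split; lra.
rewrite ler_piMr ?powR_ge0//; apply: le1 => //; apply/andP; split; lra.
Qed.

Lemma ReD1_gt0 z : 0 < Re z -> 0 < Re (z + 1).
Proof. by move=> z0; rewrite cReD /= addr_gt0. Qed.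

(** The boundary terms of t^omega (1 - t)^w vanish, so its derivative has integral 0. *)
Lemma cBeta_parts omega w : 0 < Re omega -> 0 < Re w ->
  omega * cBeta omega (w + 1) = w * cBeta (omega + 1) w.
Proof.
move=> o0 w0; have o1 := ReD1_gt0 o0; have w1 := ReD1_gt0 w0.
have i1 := Cintegrable01Z omega (beta_kernel_integrable o0 w1).
have i2 := Cintegrable01Z (- w) (beta_kernel_integrable o1 w0).
apply/eqP; rewrite -subr_eq0 !cBetaE -mulNr -!Cintegral01Z; [|exact: beta_kernel_integrable..].
rewrite -Cintegral01D//; apply/eqP.
have [l1 l2] := beta_kernel_cvg0 o0 w0.
apply: (Cintegral01_derive _ _ _ (Cintegrable01D i1 i2) l1 l2) => t t01.
- by rewrite mulNr; exact: is_cderive_beta_kernel.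
- have [c1 c2] := beta_kernel_continuous omega (w + 1) t01.
  have [c3 c4] := beta_kernel_continuous (omega + 1) w t01.
  rewrite (_ : (fun x => _) = fun x => (Re omega * Re (beta_kernel omega (w + 1) x) -
    Im omega * Im (beta_kernel omega (w + 1) x)) + (Re (- w) * Re (beta_kernel (omega + 1) w x)
    - Im (- w) * Im (beta_kernel (omega + 1) w x))); last first.
    by apply/funext => x; rewrite cReD (cReM omega) (cReM (- w)).
  by apply: cvgD; apply: cvgB; apply: cvgM => //; exact: cvg_cst.
- have [c1 c2] := beta_kernel_continuous omega (w + 1) t01.
  have [c3 c4] := beta_kernel_continuous (omega + 1) w t01.
  rewrite (_ : (fun x => _) = fun x => (Re omega * Im (beta_kernel omega (w + 1) x) +
    Im omega * Re (beta_kernel omega (w + 1) x)) + (Re (- w) * Im (beta_kernel (omega + 1) w x)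
    + Im (- w) * Re (beta_kernel (omega + 1) w x))); last first.
    by apply/funext => x; rewrite cImD (cImM omega) (cImM (- w)).
  by apply: cvgD; apply: cvgD; apply: cvgM => //; exact: cvg_cst.
Qed.

(** The kernel is multiplied by t + (1 - t) = 1. *)
Lemma cBeta_split omega w : 0 < Re omega -> 0 < Re w ->
  cBeta omega w = cBeta (omega + 1) w + cBeta omega (w + 1).
Proof.
move=> o0 w0; rewrite !cBetaE -Cintegral01D;
  [|by apply: beta_kernel_integrable => //; exact: ReD1_gt0..].
apply: eq_Cintegral01 => t /andP[t0 t1]; rewrite /beta_kernel !addrK.
rewrite !cpow_subr1 ?subr_gt0//.
have h0 : (t%:C : R[i]) != 0 by rewrite fmorph_eq0 gt_eqF.
have h1 : ((1 - t)%:C : R[i]) != 0 by rewrite fmorph_eq0 gt_eqF ?subr_gt0.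
rewrite !fmorphV; move: h1; rewrite rmorphB rmorph1 => h1.
field; rewrite h0 h1//.
Qed.

Lemma cBetaD1l omega w : 0 < Re omega -> 0 < Re w ->
  omega * cBeta omega w = (omega + w) * cBeta (omega + 1) w.
Proof.
move=> o0 w0; rewrite cBeta_split// mulrDr cBeta_parts// mulrDl; ring.
Qed.

Lemma cBetaD1r omega w : 0 < Re omega -> 0 < Re w ->
  w * cBeta omega w = (omega + w) * cBeta omega (w + 1).
Proof.
move=> o0 w0; rewrite cBeta_split// mulrDr -cBeta_parts// mulrDl; ring.
Qed.

End ComplexBeta.

(** * Non-vanishing of the beta function *)

Section BetaNeq0.
Local Open Scope classical_set_scope.
Context {R : realType}.
Local Notation Re := complex.Re.
Local Notation Im := complex.Im.
Local Notation normc := Normc.normc.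
Local Notation mu := (@lebesgue_measure R).
Local Notation I01 := (`]0%R, 1%R[%classic : set R).
Implicit Types (t : R) (z v omega w : R[i]).

Lemma Re_gt0_neq0 z : 0 < Re z -> z != 0.
Proof. by move=> z0; apply/eqP => zE; rewrite zE ltxx in z0. Qed.

Lemma Re_addn_gt0 z n : 0 < Re z -> 0 < Re (z + n%:R).
Proof. by move=> z0; rewrite cReD natC /= ltr_wpDr. Qed.

(** In the recurrences the factor in front of the raised beta value has positive real part, so a
    zero of B spreads along the whole diagonal. *)
Lemma cBeta_eq0_addn omega w n : 0 < Re omega -> 0 < Re w ->
  cBeta omega w = 0 -> cBeta (omega + n%:R) (w + n%:R) = 0.
Proof.
move=> o0 w0 B0; elim: n => [|n IH]; first by rewrite !addr0.
have [p1 w1] := (Re_addn_gt0 n o0, Re_addn_gt0 n w0).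
have : cBeta (omega + n%:R + 1) (w + n%:R) = 0.
  move: (cBetaD1l p1 w1) => /esym; rewrite IH mulr0 => /eqP.
  rewrite mulf_eq0 => /orP[|/eqP//]; rewrite (negbTE (Re_gt0_neq0 _))//.
  by rewrite cReD addr_gt0.
have p2 := ReD1_gt0 p1.
move=> IH2; move: (cBetaD1r p2 w1) => /esym; rewrite IH2 mulr0 => /eqP.
rewrite mulf_eq0 => /orP[|/eqP]; first by rewrite (negbTE (Re_gt0_neq0 _))// cReD addr_gt0.
by rewrite -[n.+1]addn1 natrD !addrA.
Qed.

Lemma beta_kernel_addn omega w m n t : 0 < t < 1 ->
  beta_kernel (omega + m%:R) (w + n%:R) t = (t ^+ m * (1 - t) ^+ n)%:C * beta_kernel omega w t.
Proof.
move=> /andP[t0 t1]; rewrite /beta_kernel ![_ + _%:R - 1]addrAC !(cpowD _ (_ - _)).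
by rewrite !cpow_nat ?subr_gt0// rmorphM /=; ring.
Qed.

(* The weight (t (1 - t))^n concentrates at t = 1/2, where the kernel does not vanish. *)
Lemma cBeta_neq0 omega w : 0 < Re omega -> 0 < Re w -> cBeta omega w != 0.
Proof.
move=> o0 w0; apply/eqP => B0.
have h01 : (0 : R) < 2^-1 < (1 : R) by apply/andP; split; lra.
have k0 : beta_kernel omega w 2^-1 != 0 by rewrite mulf_neq0// cpow_neq0//; lra.
(* Normalised to the value 1 at 1/2, so that its real part stays above 1/2 nearby. *)
pose h t := (beta_kernel omega w 2^-1)^-1 * beta_kernel omega w t.
have ih : Cintegrable01 h by apply: Cintegrable01Z; exact: beta_kernel_integrable.
have mh : cmeasurable h.
  by apply: cmeasurableM; [exact: cmeasurable_cst|exact: cmeasurable_beta_kernel].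
have ch : {for 2^-1, continuous (fun t : R => Re (h t))}.
  have [c1 c2] := beta_kernel_continuous omega w h01.
  rewrite (_ : (fun t => _) = fun t => Re (beta_kernel omega w 2^-1)^-1 * Re (beta_kernel omega w t) -
    Im (beta_kernel omega w 2^-1)^-1 * Im (beta_kernel omega w t)).
    by apply: cvgB; apply: cvgM => //; exact: cvg_cst.
  by apply/funext => t; rewrite /h cReM.
have [d d0 [d2 dh]] : exists2 d : R, 0 < d & d < 2^-1 /\ forall t, `|t - 2^-1| < d -> 2^-1 <= Re (h t).
  have h1 : Re (h 2^-1) = 1 by rewrite /h mulVf.
  move: ch => /cvgrPdist_lt /(_ 2^-1); rewrite invr_gt0 ltr0n => /(_ erefl).
  move=> [e e0 he]; exists (Num.min e 4^-1); first by rewrite lt_min e0 invr_gt0 ltr0n.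
  split; first by rewrite gt_min; apply/orP; right; lra.
  move=> t; rewrite lt_min distrC => /andP[td _].
  have : `|Re (h 2^-1) - Re (h t)| < 2^-1 by exact: he.
  by rewrite h1; move: (Re (h t)) => r /ltr_normlP[? ?]; lra.
(* Since t (1 - t) = 1/4 - (t - 1/2)^2, this product is at least A within distance d/2 of 1/2 and at
   most B beyond distance d. *)
pose A := 4^-1 - (d / 2) ^+ 2; pose B := 4^-1 - d ^+ 2.
have B_gt0 : 0 < B by rewrite /B; nra.
have AB : B < A by rewrite /A /B; nra.
have A_gt0 := lt_trans B_gt0 AB.
pose E : set R := `[2^-1 - d / 2, 2^-1 + d / 2]%classic.
have EI : E `<=` I01.
  by move=> t; rewrite /E /= !in_itv /= => /andP[? ?]; apply/andP; split; lra.
pose N := \int[mu]_(t in I01) normc (h t).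
have iN := Cintegrable01_norm mh ih.
have key n : 2^-1 * A ^+ n * d <= B ^+ n * N.
  pose f t : R := Re ((t ^+ n * (1 - t) ^+ n)%:C * h t).
  have [if1 if2] : Cintegrable01 (fun t => (t ^+ n * (1 - t) ^+ n)%:C * h t).
    have := Cintegrable01Z (beta_kernel omega w 2^-1)^-1
      (beta_kernel_integrable (Re_addn_gt0 n o0) (Re_addn_gt0 n w0)).
    apply: eq_Cintegrable01 => t t01; rewrite beta_kernel_addn// /h; ring.
  have f0 : \int[mu]_(t in I01) f t = 0.
    have := Cintegral01Z (beta_kernel omega w 2^-1)^-1
      (beta_kernel_integrable (Re_addn_gt0 n o0) (Re_addn_gt0 n w0)).
    rewrite -cBetaE cBeta_eq0_addn// mulr0 => /(congr1 (@complex.Re R)) I0.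
    apply: etrans I0; apply: eq_Rintegral => t /set_mem/in01 t01.
    by rewrite /f beta_kernel_addn// /h; congr Re; ring.
  (* The minorant of f is g - B^n |h|: within distance d/2 it uses the lower bound A^n, between d/2
     and d only the sign of Re h, and beyond d the upper bound B^n. *)
  pose g t : R := (cst (2^-1 * A ^+ n) \_ E) t.
  have ig : mu.-integrable I01 (EFin \o g).
    rewrite /g -restrict_EFin; apply/integrable_restrict; [exact: measurable_itv..|].
    rewrite (setIidr EI); apply: continuous_compact_integrable; first exact: segment_compact.
    by apply: continuous_in_subspaceT => ? _; exact: cvg_cst.
  have iBN := RintegralZ_EFin (B ^+ n) iN.
  have : \int[mu]_(t in I01) (g t - B ^+ n * normc (h t)) <= \int[mu]_(t in I01) f t.
    apply: le_Rintegral => //.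
      have := @integrableB _ _ _ mu I01 (measurable_itv _) _ _ ig iBN.
      by apply: eq_integrable => // t _ /=; rewrite EFinB.
    move=> t /in01/andP[t0 t1]; rewrite /f cReZ -exprMn.
    set V := t * (1 - t).
    have V0 : 0 < V by rewrite mulr_gt0// subr_gt0.
    have VE : V = 4^-1 - (t - 2^-1) ^+ 2 by rewrite /V; field.
    have nh := normRe_le (h t).
    have [td|td] := ltP `|t - 2^-1| d.
      have h2 := dh _ td.
      have gV : g t <= V ^+ n * 2^-1.
        rewrite /g patchE; case: ifPn => [|_]; last by rewrite mulr_ge0// exprn_ge0// ltW.
        rewrite inE /E /= in_itv /= => /andP[t3 t4].
        rewrite mulrC ler_pM2r ?invr_gt0 ?ltr0n//; apply: lerXn2r; rewrite ?nnegrE ?(ltW A_gt0) ?(ltW V0)//.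
        have : 0 <= (d / 2 - (t - 2^-1)) * (d / 2 + (t - 2^-1)) by apply: mulr_ge0; lra.
        by rewrite VE /A; lra.
      have Vn : 0 <= V ^+ n by rewrite exprn_ge0// ltW.
      have Bn : 0 <= B ^+ n * normc (h t) by rewrite mulr_ge0 ?normc_ge0// exprn_ge0// ltW.
      move: h2 gV Vn Bn.
      move: (B ^+ n * _) (Re (h t)) (V ^+ n) (g t) => a b c e; clear => *; nra.
    have -> : g t = 0.
      rewrite /g patchE; case: ifPn => //; rewrite inE /E /= in_itv /= => /andP[t3 t4].
      by move: td; rewrite leNgt => /negP; case; rewrite ltr_norml; apply/andP; split; lra.
    have VB : V ^+ n <= B ^+ n.
      apply: lerXn2r; rewrite ?nnegrE ?(ltW B_gt0) ?(ltW V0)//.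
      have : d ^+ 2 <= (t - 2^-1) ^+ 2.
        by rewrite -[X in _ <= X]real_normK ?num_real// lerXn2r ?nnegrE ?normr_ge0 ?(ltW d0).
      by rewrite VE /B; lra.
    have Vn : 0 <= V ^+ n by rewrite exprn_ge0// ltW.
    have hn : - Re (h t) <= normc (h t) by rewrite (le_trans (ler_norm _))// normrN.
    move: (normc_ge0 (h t)) hn Vn VB.
    move: (normc (h t)) (Re (h t)) (V ^+ n) (B ^+ n) => a b c e; clear => *; nra.
  rewrite f0 RintegralB//.
  rewrite RintegralZl//.
  rewrite subr_le0 -/N; apply: le_trans.
  rewrite /g -Rintegral_mkcondr (setIidr EI) Rintegral_cst; last exact: measurable_itv.
  rewrite /E /= lebesgue_measure_itv /= lte_fin.
  rewrite (_ : (2^-1 - d / 2 < 2^-1 + d / 2) = true); last by apply/idP; lra.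
  by rewrite -EFinD /= ler_pM2l ?mulr_gt0 ?invr_gt0 ?exprn_gt0//; lra.
(* By [key], d is at most (B / A)^n * 2 N for every n, and this tends to 0 because B < A. *)
have lim : (B / A) ^+ n * (2 * N) @[n --> \oo] --> (0 * (2 * N) : R).
  apply: cvgM; last exact: cvg_cst.
  apply: cvg_expr; rewrite ger0_norm ?divr_ge0 ?ltW// ltr_pdivrMr ?mul1r//.
have : d <= 0 * (2 * N).
  rewrite -(cvg_lim _ lim)//; apply: limr_ge; first by apply/cvg_ex; eexists; exact: lim.
  apply: nearW => n.
  have := key n; rewrite expr_div_n.
  have := exprn_gt0 n A_gt0; move: (A ^+ n) (B ^+ n) => An Bn An0 k.
  rewrite mulrAC ler_pdivlMr//; lra.
by rewrite mul0r leNgt d0.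
Qed.

End BetaNeq0.

(** * Gauss' product and the Pochhammer symbol *)

Section GaussProduct.
Local Open Scope classical_set_scope.
Context {R : realType}.
Local Notation Re := complex.Re.
Local Notation Im := complex.Im.
Local Notation normc := Normc.normc.
Implicit Types (t : R) (z : R[i]).

(** The bound on the increments makes a + c decrease and a - c increase. As c >= 0, the former stays
    above a 0 - c 0, hence converges, and c tends to 0. *)
Lemma cvg_bounded_variation (a c : nat -> R) :
  (forall n, `|a n.+1 - a n| <= c n - c n.+1) -> c n @[n --> \oo] --> (0 : R) ->
  cvgn a.
Proof.
move=> ac c0.
have cn n : c n.+1 <= c n by rewrite -subr_ge0 (le_trans _ (ac n)).
have dc : nonincreasing_seq c by apply/nonincreasing_seqP.
have c_ge0 n : 0 <= c n.
  rewrite -(cvg_lim _ c0)//; apply: nonincreasing_cvgn_ge => //.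
  by apply/cvg_ex; eexists; exact: c0.
have low n : a 0%N - c 0%N <= a n - c n.
  elim: n => // n IH; apply: le_trans IH _.
  by have /ler_normlP[] := ac n; lra.
have icv : cvgn (fun n => a n + c n).
  apply: nonincreasing_is_cvgn.
    by apply/nonincreasing_seqP => n; have /ler_normlP[] := ac n; lra.
  exists (a 0%N - c 0%N) => _ [n _ <-].
  by have := low n; have := c_ge0 n; lra.
rewrite (_ : a = (fun n => (a n + c n) - c n)).
  by apply: is_cvgB => //; apply/cvg_ex; eexists; exact: c0.
by apply/funext => n; rewrite addrK.
Qed.

(* For n >= 1, sum_(k >= n) 1 / k^2 <= 1 / (n - 1), by telescoping; a start N > 2 K + 1 thus keeps
   the products of the factors r k within a factor 2 of 1. *)
Lemma cvg_mul_ratio (g r : nat -> R[i]) (K : R) : 0 <= K ->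
  (forall n, (0 < n)%N -> g n.+1 = g n * r n) ->
  (forall n, (0 < n)%N -> normc (r n - 1) <= K / n%:R ^+ 2) ->
  (forall n, (0 < n)%N -> g n != 0) ->
  exists2 l : R[i], l != 0 & (g n : R[i]^o) @[n --> \oo] --> (l : R[i]^o).
Proof.
move=> K0 gr rK g0.
have [N N2 NK] : exists2 N : nat, (1 < N)%N & 2 * K <= N.-1%:R.
  by exists (Num.truncn (2 * K)).+2 => //=; apply/ltW; exact: truncnS_gt.
(* A closed-form lower bound for the partial products of 1 - [y k]: it starts at 1, drops by at
   least [y k] at each step and never falls below 1/2. *)
pose s k : R := 1 - K / N.-1%:R + K / (N + k).-1%:R.
pose y k : R := K / (N + k)%:R ^+ 2.
have N1 : (0 : R) < N.-1%:R by rewrite ltr0n -ltnS prednK// ltnW.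
have y0 k : 0 <= y k by rewrite divr_ge0// exprn_ge0.
have ss k : y k <= s k - s k.+1.
  have -> : s k - s k.+1 = K * ((N + k).-1%:R^-1 - (N + k)%:R^-1).
    by rewrite /s addnS /=; ring.
  rewrite ler_wpM2l//; have : (1 < N + k)%N by rewrite ltn_addr.
  case: (N + k)%N => [|[|m]] // _ /=.
  have m1 : (0 : R) < m.+1%:R by rewrite ltr0n.
  have -> : m.+2%:R = m.+1%:R + 1 :> R by rewrite -natr1.
  move: (m.+1%:R : R) m1 => x x0.
  rewrite -subr_ge0 (_ : _ - _ = (x * (x + 1) ^+ 2)^-1).
    by rewrite invr_ge0 mulr_ge0 ?exprn_ge0//; lra.
  by field; apply/andP; split; apply/lt0r_neq0; lra.
have s1 k : s k <= 1.
  elim: k => [|k IH]; first by rewrite /s addn0 subrK.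
  by have := ss k; have := y0 k; lra.
have s2 k : 2^-1 <= s k.
  have h1 : K / N.-1%:R <= 2^-1 by rewrite ler_pdivrMr//; lra.
  have h2 : 0 <= K / (N + k).-1%:R by rewrite divr_ge0.
  by rewrite /s; lra.
have Nk k : (0 < N + k)%N by rewrite addn_gt0 (ltnW N2).
pose G k := normc (g (N + k)%N); pose G0 := G 0%N.
have G0_gt0 : 0 < G0 by rewrite /G0 /G normc_gt0// g0.
have Gk k : G0 * s k <= G k /\ G k * s k <= G0.
  elim: k => [|k [IH1 IH2]].
    have -> : s 0%N = 1 by rewrite /s addn0 subrK.
    by rewrite !mulr1.
  have rk := rK _ (Nk k); rewrite -/(y k) in rk.
  have r1 : 1 - y k <= normc (r (N + k)%N).
    have := normcD (r (N + k)%N) (1 - r (N + k)%N).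
    by rewrite subrKC Normc.normc1 -(normcN (1 - _)) opprB; lra.
  have r2 : normc (r (N + k)%N) <= 1 + y k.
    have := normcD (r (N + k)%N - 1) 1.
    by rewrite subrK Normc.normc1; lra.
  have -> : G k.+1 = G k * normc (r (N + k)%N) by rewrite /G addnS gr// Normc.normcM.
  move: (ss k) (s1 k) (s2 k) (s2 k.+1) (y0 k) r1 r2 IH1 IH2.
  have : 0 < G k by rewrite /G normc_gt0// g0.
  move: G0 G0_gt0 (G k) (normc (r _)) (s k) (s k.+1) (y k).
  clear => a a0 b c s s' y b0 sy s1 s2 s2' y0 c1 c2 h1 h2.
  have y1 : 0 <= 1 - y by lra.
  have e1 : s' <= s * (1 - y) by nra.
  have e2 : (1 + y) * s' <= s by nra.
  split.
    apply: (le_trans (ler_wpM2l (ltW a0) e1)); rewrite mulrA.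
    apply: (le_trans (ler_wpM2r y1 h1)); exact: (ler_wpM2l (ltW b0) c1).
  have s'0 : 0 <= s' by lra.
  apply: (le_trans (ler_wpM2r s'0 (ler_wpM2l (ltW b0) c2))).
  by apply: le_trans h2; rewrite -mulrA ler_wpM2l ?(ltW b0).
have G_ge k : G0 / 2 <= G k by have [h _] := Gk k; have := s2 k; nra.
have G_le k : G k <= 2 * G0.
  have [_ h] := Gk k; have := s2 k; have : 0 <= G k by exact: normc_ge0.
  by nra.
(* Since G k <= 2 G0, the increments of g are dominated by those of 2 G0 s; the limit of the latter
   is subtracted so that c tends to 0. *)
pose c k := 2 * G0 * s k - 2 * G0 * (1 - K / N.-1%:R).
have c_cvg : c k @[k --> \oo] --> (0 : R).
  have -> : c = fun k => 2 * G0 * K * (k + N.-1)%:R^-1.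
    apply/funext => k; rewrite /c /s -!subn1 -addnBAC ?(ltnW N2)// addnC; ring.
  rewrite -[X in _ --> X](mulr0 (2 * G0 * K)); apply: cvgMr.
  have : (fun n => n.+1%:R^-1 : R) n @[n --> \oo] --> (0 : R) by exact: cvg_harmonic.
  rewrite -(cvg_shiftn N.-2) => h; under eq_fun => k.
    have -> : (k + N.-1)%N = (k + N.-2).+1 by rewrite -addnS prednK// -ltnS prednK// ltnW.
    over.
  exact: h.
have diff k : normc (g (N + k.+1)%N - g (N + k)%N) <= c k - c k.+1.
  rewrite addnS gr// -[X in _ - X]mulr1 -mulrBr Normc.normcM -/(G k).
  have := rK _ (Nk k); rewrite -/(y k) => rk.
  have := ss k; have := G_le k; have := y0 k.
  have : 0 <= G k by exact: normc_ge0.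
  have := normc_ge0 (r (N + k)%N - 1).
  rewrite /c; nra.
have cR : cvgn (fun k => Re (g (N + k)%N)).
  apply: (cvg_bounded_variation (c := c)) => // k.
  by apply: le_trans (diff k); rewrite -cReN -cReD; exact: normRe_le.
have cI : cvgn (fun k => Im (g (N + k)%N)).
  apply: (cvg_bounded_variation (c := c)) => // k.
  by apply: le_trans (diff k); rewrite -cImN -cImD; exact: normIm_le.
set a := limn (fun k => Re (g (N + k)%N)) in cR.
set b := limn (fun k => Im (g (N + k)%N)) in cI.
have cv : (g (N + k)%N : R[i]^o) @[k --> \oo] --> (a +i* b : R[i]^o) by apply/cvg_complexP.
exists (a +i* b); last first.
  rewrite -(cvg_shiftn N); under eq_fun do rewrite addnC.
  exact: cv.
suff : G0 / 2 <= `|a| + `|b|.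
  by move=> h; apply/eqP => -[ae be]; move: h; rewrite ae be normr0; lra.
have cab : `|Re (g (N + k)%N)| + `|Im (g (N + k)%N)| @[k --> \oo] --> `|a| + `|b|.
  by apply: cvgD; apply: cvg_norm.
rewrite -(cvg_lim _ cab)//; apply: limr_ge; first by apply/cvg_ex; eexists; exact: cab.
by apply: nearW => k; apply: le_trans (G_ge k) _; exact: normc_le.
Qed.

End GaussProduct.

(** * Convergence of Gauss' product, the functional equation and Pochhammer symbols *)

Section Gamma.
Local Open Scope classical_set_scope.
Context {R : realType}.
Local Notation Re := complex.Re.
Local Notation Im := complex.Im.
Local Notation normc := Normc.normc.
Implicit Types (t : R) (z : R[i]).

(** The mean value theorem applied twice; this gives C in place of the sharp C / 2. *)
Lemma taylor1_le (h h1 h2 : R -> R) (C a b : R) : a <= b -> 0 <= C ->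
  (forall t, a <= t <= b -> is_derive t 1 h (h1 t)) ->
  (forall t, a <= t <= b -> is_derive t 1 h1 (h2 t)) ->
  (forall t, a <= t <= b -> `|h2 t| <= C) ->
  `|h b - h a - h1 a * (b - a)| <= C * (b - a) ^+ 2.
Proof.
move=> ab C0 d1 d2 hC.
have mvt (f f1 : R -> R) c : a <= c <= b -> (forall t, a <= t <= b -> is_derive t 1 f (f1 t)) ->
    exists2 d, a <= d <= c & f c - f a = f1 d * (c - a).
  move=> /andP[ac cb] df.
  have [||d] := @MVT_segment _ f f1 _ _ ac.
  - move=> t; rewrite in_itv /= => /andP[t1 t2]; apply: df.
    by rewrite (ltW t1) (le_trans (ltW t2)).
  - apply: continuous_within => t /andP[t1 t2]; apply: is_derive1_continuous.
    by apply: df; rewrite t1 (le_trans t2).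
  by rewrite in_itv /=; exists d.
have [c /andP[ac cb] ->] := mvt h h1 b (introT andP (conj ab (lexx b))) d1.
have [d /andP[ad dc] e] := mvt h1 h2 c (introT andP (conj ac cb)) d2.
rewrite -mulrBl e !normrM (ger0_norm (_ : 0 <= c - a)) ?subr_ge0//.
rewrite (ger0_norm (_ : 0 <= b - a)) ?subr_ge0// expr2 mulrA ler_wpM2r ?subr_ge0//.
apply: ler_pM => //; first by rewrite subr_ge0.
  by apply: hC; rewrite ad (le_trans dc).
by rewrite lerB.
Qed.

Lemma is_cderive_cpowZ (c z : R[i]) t : 0 < t ->
  is_cderive t (fun x => c * cpow x z) (c * (z * cpow t (z - 1))).
Proof.
move=> t0; have := is_cderiveM (is_cderive_cst t c) (is_cderive_cpow z t0).
by rewrite mul0r add0r.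
Qed.

(** Second-order Taylor estimate at 1, used with x = 1/n. On [1, 2] one has |t^(z - 2)| <= t^(Re z)
    <= 2^(Re z), and treating real and imaginary parts separately doubles the constant. *)
Lemma cpow1D_le z : 0 < Re z -> exists2 C : R, 0 <= C &
  forall x : R, 0 <= x <= 1 -> normc (cpow (1 + x) z - 1 - z * x%:C) <= C * x ^+ 2.
Proof.
move=> z0; pose C := normc (z * (z - 1)) * 2 `^ Re z.
have C0 : 0 <= C by rewrite mulr_ge0 ?normc_ge0 ?powR_ge0.
exists (2 * C); first by rewrite mulr_ge0.
move=> x /andP[x0 x1].
have d1 t : 1 <= t <= 1 + x -> is_cderive t (fun x => cpow x z) (z * cpow t (z - 1)).
  by move=> /andP[t1 _]; apply: is_cderive_cpow; lra.
have d2 t : 1 <= t <= 1 + x ->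
    is_cderive t (fun x => z * cpow x (z - 1)) (z * ((z - 1) * cpow t (z - 1 - 1))).
  by move=> /andP[t1 _]; apply: is_cderive_cpowZ; lra.
have nC t : 1 <= t <= 1 + x -> normc (z * ((z - 1) * cpow t (z - 1 - 1))) <= C.
  move=> /andP[t1 t2]; have t0 : 0 < t by lra.
  rewrite mulrA Normc.normcM ler_wpM2l ?normc_ge0// normc_cpow//.
  apply: (@le_trans _ _ (t `^ Re z)).
    by apply: ler_powR => //; rewrite !cReD !cReN /=; lra.
  by apply: ge0_ler_powR; rewrite ?nnegrE; lra.
have x1' : 1 <= 1 + x by lra.
have e : 1 + x - 1 = x by rewrite addrC addKr.
have := @taylor1_le (fun x => Re (cpow x z)) (fun x => Re (z * cpow x (z - 1)))
  (fun t => Re (z * ((z - 1) * cpow t (z - 1 - 1)))) C _ _ x1' C0.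
have := @taylor1_le (fun x => Im (cpow x z)) (fun x => Im (z * cpow x (z - 1)))
  (fun t => Im (z * ((z - 1) * cpow t (z - 1 - 1)))) C _ _ x1' C0.
have c1 v : cpow (1 : R) v = 1 by rewrite /cpow ln1 mulr0 cexp0.
rewrite e !c1 mulr1 => hI hR.
have {}hI : `|Im (cpow (1 + x) z) - Im (1 : R[i]) - Im z * x| <= C * x ^+ 2.
  apply: hI => t t12; [by case: (d1 _ t12)|by case: (d2 _ t12)|].
  by apply: le_trans (nC _ t12); exact: normIm_le.
have {}hR : `|Re (cpow (1 + x) z) - Re (1 : R[i]) - Re z * x| <= C * x ^+ 2.
  apply: hR => t t12; [by case: (d1 _ t12)|by case: (d2 _ t12)|].
  by apply: le_trans (nC _ t12); exact: normRe_le.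
apply: (le_trans (normc_le _)); rewrite mulrDl mul1r mulrDl.
by apply: lerD; [move: hR|move: hI]; rewrite [z * _]mulrC ?cReD ?cReN ?cReZ ?cImD ?cImN ?cImZ [x * _]mulrC.
Qed.

Lemma cpowM (s t : R) z : 0 < s -> 0 < t -> cpow (s * t) z = cpow s z * cpow t z.
Proof. by move=> s0 t0; rewrite /cpow lnM ?posrE// rmorphD mulrDr cexpD. Qed.

Definition gauss z (n : nat) : R[i] :=
  n`!%:R * cpow n%:R z / \prod_(k < n.+1) (z + k%:R).

Lemma Re_addn_neq0 z (k : nat) : 0 < Re z -> z + k%:R != 0.
Proof. by move=> z0; apply: Re_gt0_neq0; exact: Re_addn_gt0. Qed.

Lemma gauss_prod_neq0 z n : 0 < Re z -> \prod_(k < n) (z + k%:R) != 0.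
Proof. by move=> z0; apply/prodf_neq0 => k _; exact: Re_addn_neq0. Qed.

Lemma natC_neq0 n : (0 < n)%N -> (n%:R : R[i]) != 0.
Proof. by rewrite natC fmorph_eq0 pnatr_eq0 -lt0n. Qed.

Lemma gauss_neq0 z n : 0 < Re z -> (0 < n)%N -> gauss z n != 0.
Proof.
move=> z0 n0; apply: mulf_neq0; last by rewrite invr_neq0// gauss_prod_neq0.
by apply: mulf_neq0; [rewrite natC_neq0 ?fact_gt0|rewrite cpow_neq0// ltr0n].
Qed.

Lemma gauss_ratio z n : 0 < Re z -> (0 < n)%N ->
  gauss z n.+1 = gauss z n *
    (n.+1%:R * cpow (1 + n%:R^-1) z / (z + n.+1%:R)).
Proof.
move=> z0 n0; rewrite /gauss [\prod_(k < n.+2) _]big_ord_recr /= factS natrM.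
have nR : 0 < n%:R :> R by rewrite ltr0n.
have -> : (n.+1%:R : R) = n%:R * (1 + n%:R^-1) by rewrite mulrDr mulfV ?gt_eqF// mulr1 natr1.
rewrite cpowM// ?addr_gt0 ?invr_gt0// invfM; ring.
Qed.

Lemma normc_addn_ge z n : 0 < Re z -> n%:R <= normc (z + n%:R).
Proof.
move=> z0; apply: le_trans (normRe_le _); rewrite cReD natC /=.
by rewrite ger0_norm ?addr_ge0 ?(ltW z0)// lerDr ltW.
Qed.

(** The ratio of consecutive terms is (1 + 1/n)^z divided by 1 + z / (n + 1). The first-order terms
    cancel up to z / n - z / (n + 1) = z / (n (n + 1)), so the ratio is 1 + O(1/n^2). *)
Lemma gauss_cvg z : 0 < Re z ->
  exists2 l : R[i], l != 0 & (gauss z n : R[i]^o) @[n --> \oo] --> (l : R[i]^o).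
Proof.
move=> z0; have [C C0 hC] := cpow1D_le z0.
apply: (@cvg_mul_ratio _ _ (fun n => n.+1%:R * cpow (1 + n%:R^-1) z / (z + n.+1%:R))
  (C + normc z)).
- by rewrite addr_ge0 ?normc_ge0.
- by move=> n n0; exact: gauss_ratio.
- move=> n n0; have nR : 0 < n%:R :> R by rewrite ltr0n.
  pose x : R := n%:R^-1.
  have x01 : 0 <= x <= 1 by rewrite invr_ge0 ltW//= invf_le1// ler1n.
  have zn : z + n.+1%:R != 0 by exact: Re_addn_neq0.
  have n1 : (n.+1%:R : R[i]) != 0 by exact: natC_neq0.
  have nC0 : (n%:R : R[i]) != 0 by exact: natC_neq0.
  have -> : n.+1%:R * cpow (1 + n%:R^-1) z / (z + n.+1%:R) - 1 =
    (cpow (1 + x) z - 1 - z * x%:C + z * (x%:C / n.+1%:R)) * (n.+1%:R / (z + n.+1%:R)).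
    rewrite /x fmorphV rmorph_nat; have : (n.+1%:R : R[i]) = n%:R + 1 by rewrite natr1.
    move: zn n1 nC0; move: (cpow _ _) (n%:R : R[i]) (n.+1%:R : R[i]) => c a b zb b0 a0 ba.
    by field: ba; apply/and3P; split.
  rewrite Normc.normcM (@le_trans _ _ ((C + normc z) * x ^+ 2 * 1))//; last first.
    by rewrite mulr1 /x exprVn.
  apply: ler_pM; rewrite ?normc_ge0//.
    apply: le_trans (normcD _ _) _; rewrite mulrDl lerD ?hC//.
    rewrite Normc.normcM ler_wpM2l ?normc_ge0// natC -fmorphV -rmorphM normcR.
    have /andP[x0 x1] := x01.
    rewrite ger0_norm ?mulr_ge0 ?invr_ge0// expr2 ler_wpM2l// /x lef_pV2 ?posrE ?ltr0n//.
    by rewrite ler_nat.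
  rewrite Normc.normcM Normc.normcV ler_pdivrMr ?normc_gt0// mul1r natC normcR.
  by rewrite ger0_norm// -natC normc_addn_ge.
- by move=> n n0; exact: gauss_neq0.
Qed.

Lemma gaussD1 z n : 0 < Re z -> (0 < n)%N ->
  gauss (z + 1) n = gauss z n * (z * (n%:R / (z + n.+1%:R))).
Proof.
move=> z0 n0; rewrite /gauss cpow_addr1 ?ltr0n// rmorph_nat.
have zz : z != 0 by exact: Re_gt0_neq0.
have E : z * \prod_(k < n.+1) (z + 1 + k%:R) = (\prod_(k < n.+1) (z + k%:R)) * (z + n.+1%:R).
  transitivity (\prod_(k < n.+2) (z + k%:R)); last by rewrite big_ord_recr.
  rewrite [RHS]big_ord_recl /= addr0; congr (_ * _).
  by apply: eq_bigr => k _; rewrite /bump /= add1n -addrA nat1r.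
have p1 := gauss_prod_neq0 n.+1 z0.
have p2 := gauss_prod_neq0 n.+1 (ReD1_gt0 z0).
have p3 : z + n.+1%:R != 0 by exact: Re_addn_neq0.
move: E p1 p2 p3; move: (\prod_(k < _) _) (\prod_(k < _) _) (cpow _ _) (n.+1%:R) => P Q c m E P0 Q0 m0.
rewrite (_ : Q^-1 = (z + m)^-1 * z * P^-1); last first.
  apply: (mulfI Q0); rewrite mulfV// mulrA.
  by field: E; rewrite m0 P0.
ring.
Qed.

Lemma cGamma_cvg z : 0 < Re z ->
  cGamma z != 0 /\ (gauss z n : R[i]^o) @[n --> \oo] --> (cGamma z : R[i]^o).
Proof. by move=> z0; have [l l0 gl] := gauss_cvg z0; rewrite /cGamma (limn_complex gl). Qed.

Lemma eq_seq_cvg (T : topologicalType) (u v : nat -> T) (l : T) :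
  (forall n, u n = v n) -> u n @[n --> \oo] --> l -> v n @[n --> \oo] --> l.
Proof. by move=> /funext ->. Qed.

Lemma cGammaD1 z : 0 < Re z -> cGamma (z + 1) = z * cGamma z.
Proof.
move=> z0; have [_ gz] := cGamma_cvg z0; have [_ gz1] := cGamma_cvg (ReD1_gt0 z0).
suff h : (n%:R / (z + n.+1%:R) : R[i]^o) @[n --> \oo] --> (1 : R[i]^o).
  have cz : ((fun=> z) n : R[i]^o) @[n --> \oo] --> (z : R[i]^o) by exact: cvg_cst.
  have cv := cvg_complexM gz (cvg_complexM cz h).
  pose u n : R[i]^o := gauss z n * (z * (n%:R / (z + n.+1%:R))).
  (* The index 0 is skipped because [gaussD1] asks for 0 < n; shifting does not change the
     limits. *)
  have us : u n.+1 @[n --> \oo] --> (cGamma z * (z * 1) : R[i]^o).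
    by rewrite (cvg_shiftS u); exact: cv.
  have gs : (gauss (z + 1) n.+1 : R[i]^o) @[n --> \oo] --> (cGamma z * (z * 1) : R[i]^o).
    by apply: eq_seq_cvg us => n; rewrite gaussD1.
  have gs' : (gauss (z + 1) n : R[i]^o) @[n --> \oo] --> (cGamma z * (z * 1) : R[i]^o).
    by rewrite -(@cvg_shiftS _ (gauss (z + 1) : nat -> R[i]^o)); exact: gs.
  have := etrans (esym (limn_complex gz1)) (limn_complex gs').
  by move=> ->; rewrite mulr1 mulrC.
have nb (n : nat) : normc (n%:R / (z + n.+1%:R) - 1) <= normc (z + 1) * n.+1%:R^-1.
  have zn : z + n.+1%:R != 0 by exact: Re_addn_neq0.
  rewrite (_ : _ - 1 = - (z + 1) / (z + n.+1%:R)).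
    rewrite Normc.normcM Normc.normcV normcN ler_wpM2l ?normc_ge0//.
    by rewrite lef_pV2 ?posrE ?ltr0n ?normc_gt0// normc_addn_ge.
  by move: zn; rewrite -natr1 => zn; field.
have lim0 : normc (z + 1) * n.+1%:R^-1 @[n --> \oo] --> (0 : R).
  rewrite -[X in _ --> X](mulr0 (normc (z + 1))); apply: cvgMr; exact: cvg_harmonic.
apply/cvg_complexP; split; apply/cvgrPdist_le => e e0;
  move/cvgrPdist_le: lim0 => /(_ _ e0); apply: filterS => n;
  rewrite sub0r normrN ger0_norm ?mulr_ge0 ?normc_ge0 ?invr_ge0//; apply: le_trans;
  apply: le_trans (nb n); rewrite distrC -?cReN -?cReD -?cImN -?cImD;
  [exact: normRe_le|exact: normIm_le].
Unshelve. all: by end_near. Qed.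

Lemma cGamma_addn z m : 0 < Re z ->
  cGamma (z + m%:R) = (\prod_(k < m) (z + k%:R)) * cGamma z.
Proof.
move=> z0; elim: m => [|m IH]; first by rewrite big_ord0 addr0 mul1r.
rewrite -natr1 addrA cGammaD1 ?Re_addn_gt0// IH big_ord_recr /=; ring.
Qed.

(** The quotient of Gamma values collapses because [cGamma z] is nonzero for Re z > 0. *)
Lemma pochhammer_prod z m : 0 < Re z -> pochhammer z m = \prod_(k < m) (z + k%:R).
Proof.
move=> z0; rewrite /pochhammer; case: eqP => [->|_]; first by rewrite big_ord0.
by rewrite cGamma_addn// mulfK//; case: (cGamma_cvg z0).
Qed.

Lemma pochhammer_neq0 z m : 0 < Re z -> pochhammer z m != 0.
Proof. by move=> z0; rewrite pochhammer_prod// gauss_prod_neq0. Qed.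

(** Induction on m by [cBetaD1l]: each step contributes the factor (omega + m) / (omega + w + m). *)
Lemma cBeta_addn (omega w : R[i]) m : 0 < Re omega -> 0 < Re w ->
  cBeta (omega + m%:R) w =
  cBeta omega w * (pochhammer omega m / pochhammer (omega + w) m).
Proof.
move=> o0 w0; have ow0 : 0 < Re (omega + w) by rewrite cReD addr_gt0.
rewrite !pochhammer_prod//; elim: m => [|m IH].
  by rewrite !big_ord0 addr0 divr1 mulr1.
have h := cBetaD1l (Re_addn_gt0 m o0) w0.
have n0 : omega + w + m%:R != 0 by exact: Re_addn_neq0.
have p0 := gauss_prod_neq0 m ow0.
rewrite -natr1 addrA !big_ord_recr /=.
apply: (mulfI n0); rewrite [omega + w + _]addrAC -h IH [omega + _ + w]addrAC.
by field; rewrite n0 p0.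
Qed.

End Gamma.

(** * Power series with infinite radius of convergence *)

Section RealPowerSeries.
Local Open Scope classical_set_scope.
Context {R : realType}.
Implicit Types (f : nat -> R) (s : R).

(** Any s lies strictly inside the disc through |s| + |c| + 1, a point beyond c where the series
    converges. *)
Lemma is_cvg_pseries_everywhere f (c : R) : (forall s, c <= s -> cvgn (pseries f s)) ->
  forall s, cvgn (pseries (fun k => `|f k|) s).
Proof.
move=> fc s; apply: (@is_cvg_pseries_inside_norm _ f (`|s| + `|c| + 1)).
  by apply: fc; have := ler_norm c; have := normr_ge0 s; lra.
have n1 := normr_ge0 s; have n2 := normr_ge0 c.
by rewrite (ger0_norm (_ : 0 <= `|s| + `|c| + 1)); lra.
Qed.

Lemma is_cvg_pseries_abs f s : (forall s, cvgn (pseries (fun k => `|f k|) s)) -> cvgn (pseries f s).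
Proof.
move=> /(_ `|s|) fc; apply: normed_cvg; rewrite (_ : [normed _]%classic = pseries (fun k => `|f k|) `|s|)//.
by apply/funext => n; apply: eq_bigr => k _; rewrite /= normrM normrX.
Qed.

Lemma is_cvg_pseries_diffs f : (forall s, cvgn (pseries (fun k => `|f k|) s)) ->
  forall s, cvgn (pseries (fun k => `|pseries_diffs f k|) s).
Proof.
move=> fc; apply: (@is_cvg_pseries_everywhere _ 1) => x x1; apply: normed_cvg.
(* For x >= 1, (k + 1) x^k <= (2 x)^(k + 1): the differentiated series at x is dominated by the
   original one at 2 x, shifted by one index. *)
pose w k := `|f k| * (2 * x) ^+ k.
have cw : cvgn (series (fun k => w k.+1)).
  have -> : series (fun k => w k.+1) = (fun n => series w n.+1 - w 0%N).
    by apply/funext => n; rewrite /series /= big_nat_recl//= addrAC subrr add0r.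
  have /cvg_ex[l wl] : cvgn (series w) := fc (2 * x).
  apply: is_cvgB; last exact: is_cvg_cst.
  by apply/cvg_ex; exists l; move: wl; rewrite -cvg_shiftS.
have x0 : 0 <= x by lra.
have x2 : 0 <= 2 * x by rewrite mulr_ge0.
apply: (@series_le_cvg _ _ (fun k => w k.+1)) cw.
- by move=> k; exact: normr_ge0.
- by move=> k; apply: mulr_ge0 => //; exact: exprn_ge0.
move=> k /=; rewrite normrM normrX (ger0_norm x0) /pseries_diffs normrM ger0_norm// /w.
rewrite mulrAC mulrC ler_wpM2l// exprMn; apply: ler_pM => //; first exact: exprn_ge0.
  by rewrite -natrX ler_nat ltnW// ltn_expl.
by rewrite exprS ler_peMl// exprn_ge0.
Qed.

(** The sum is even differentiable, since convergence everywhere survives two formal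
    differentiations. *)
Lemma pseries_continuous f : (forall s, cvgn (pseries (fun k => `|f k|) s)) ->
  continuous (fun s => limn (pseries f s)).
Proof.
move=> fc s.
have fd := is_cvg_pseries_diffs fc; have fdd := is_cvg_pseries_diffs fd.
have := @pseries_snd_diffs _ f (`|s| + 1) s
  (@is_cvg_pseries_abs _ _ fc) (@is_cvg_pseries_abs _ _ fd) (@is_cvg_pseries_abs _ _ fdd).
have h : `|s| < `| (`|s| + 1) |.
  by have n1 := normr_ge0 s; rewrite (ger0_norm (_ : 0 <= `|s| + 1)); lra.
by move=> /(_ h) /is_derive1_continuous.
Qed.

End RealPowerSeries.

(** * Entire series with complex coefficients at real points *)

Section EntireSeries.
Local Open Scope classical_set_scope.
Context {R : realType}.
Local Notation Re := complex.Re.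
Local Notation Im := complex.Im.
Local Notation normc := Normc.normc.
Variable d : nat -> R[i].

(** The variable is real, like rho / (t (1 - t)); real and imaginary parts are then real power
    series. *)
Definition cseries (s : R) (n : nat) : R[i]^o := \sum_(0 <= k < n) d k * (s ^+ k)%:C.

Hypothesis cvg_d : exists c : R, forall s, c <= s -> cvgn (cseries s).

Lemma Re_cseries s n : Re (cseries s n) = pseries (fun k => Re (d k)) s n.
Proof.
by rewrite /cseries Re_sum; apply: eq_bigr => k _; rewrite mulrC cReZ mulrC.
Qed.

Lemma Im_cseries s n : Im (cseries s n) = pseries (fun k => Im (d k)) s n.
Proof.
by rewrite /cseries Im_sum; apply: eq_bigr => k _; rewrite mulrC cImZ mulrC.
Qed.

Lemma Re_coef_cvg s : cvgn (pseries (fun k => `|Re (d k)|) s).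
Proof.
have [c hc] := cvg_d; apply: (@is_cvg_pseries_everywhere _ _ c) => x /hc /cvg_ex[/= l].
move=> /cvg_complexP[h _]; apply/cvg_ex; exists (Re l).
by apply: eq_seq_cvg h => n; exact: Re_cseries.
Qed.

Lemma Im_coef_cvg s : cvgn (pseries (fun k => `|Im (d k)|) s).
Proof.
have [c hc] := cvg_d; apply: (@is_cvg_pseries_everywhere _ _ c) => x /hc /cvg_ex[/= l].
move=> /cvg_complexP[_ h]; apply/cvg_ex; exists (Im l).
by apply: eq_seq_cvg h => n; exact: Im_cseries.
Qed.

(** The sum of the series, encoded componentwise so that real power series theory gives its
    continuity. *)
Definition entire (s : R) : R[i] :=
  limn (pseries (fun k => Re (d k)) s) +i* limn (pseries (fun k => Im (d k)) s).

Lemma cseries_cvg s : cseries s n @[n --> \oo] --> (entire s : R[i]^o).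
Proof.
have h1 : pseries (fun k => Re (d k)) s n @[n --> \oo] --> Re (entire s).
  exact: (@is_cvg_pseries_abs _ _ s Re_coef_cvg).
have h2 : pseries (fun k => Im (d k)) s n @[n --> \oo] --> Im (entire s).
  exact: (@is_cvg_pseries_abs _ _ s Im_coef_cvg).
apply/cvg_complexP; split; [apply: eq_seq_cvg h1 => n|apply: eq_seq_cvg h2 => n].
  by rewrite Re_cseries.
by rewrite Im_cseries.
Qed.

Lemma Re_entire_continuous : continuous (fun s => Re (entire s)).
Proof. exact: pseries_continuous Re_coef_cvg. Qed.

Lemma Im_entire_continuous : continuous (fun s => Im (entire s)).
Proof. exact: pseries_continuous Im_coef_cvg. Qed.

Lemma normc_entire_continuous : continuous (fun s => normc (entire s)).
Proof.
move=> s.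
have cR : {for s, continuous (fun s => Re (entire s))} by exact: Re_entire_continuous.
have cI : {for s, continuous (fun s => Im (entire s))} by exact: Im_entire_continuous.
pose g s := Re (entire s) * Re (entire s) + Im (entire s) * Im (entire s).
have c2 : {for s, continuous g} by exact: cvgD (cvgM cR cR) (cvgM cI cI).
rewrite (_ : (fun s => normc (entire s)) = Num.sqrt \o g).
  by apply: continuous_comp => //; exact: sqrt_continuous.
by apply/funext => x; rewrite /g /= -!expr2.
Qed.

(** Bounds all partial sums on [0, s] at once, as dominated convergence requires in
    [beta_entire]. *)
Definition majorant (s : R) : R :=
  limn (pseries (fun k => `|Re (d k)|) s) + limn (pseries (fun k => `|Im (d k)|) s).

Lemma normc_cseries_le r s n : 0 <= r <= s -> normc (cseries r n) <= majorant s.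
Proof.
move=> /andP[r0 rs]; have s0 := le_trans r0 rs.
have bound (f : nat -> R) : (forall s, cvgn (pseries (fun k => `|f k|) s)) ->
    `|pseries f r n| <= limn (pseries (fun k => `|f k|) s).
  move=> fc; apply: (@le_trans _ _ (pseries (fun k => `|f k|) s n)).
    apply: (le_trans (ler_norm_sum _ _ _)); apply: ler_sum => k _.
    rewrite normrM normrX (ger0_norm r0) ler_wpM2l//; apply: lerXn2r => //; exact: nnegrE.
  apply: nondecreasing_cvgn_le => //; apply/nondecreasing_seqP => m.
  by rewrite /pseries /series /= big_nat_recr//= lerDl mulr_ge0// exprn_ge0.
apply: (le_trans (normc_le _)); rewrite Re_cseries Im_cseries.
by apply: lerD; apply: bound; [exact: Re_coef_cvg|exact: Im_coef_cvg].
Qed.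

End EntireSeries.

(** * A bound uniform in rho *)

Section UniformBound.
Local Open Scope classical_set_scope.
Context {R : realType}.
Local Notation mu := (@lebesgue_measure R).
Local Notation I01 := (`]0%R, 1%R[%classic : set R).
Implicit Types (a b e rho t u : R) (f h : R -> R).

Definition scaled_integrand a b h rho t : R :=
  beta_weight a b t * h (rho / (t * (1 - t))).

(** The model integrand near t = 0 in the variable u = t (1 - t) / rho. It no longer contains
    rho. *)
Definition transported a h u : R := u `^ (a - 1) * h u^-1.

Lemma transported_continuous a h u : 0 < u -> continuous h ->
  {for u, continuous (transported a h)}.
Proof.
move=> u0 ch; apply: cvgM; first exact: is_derive1_continuous (is_derive1_powR _ u0).
have ci : {for u, continuous (fun x : R => x^-1)}.
  by apply: inv_continuous; rewrite gt_eqF.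
exact: (continuous_comp ci (ch _)).
Qed.

Lemma is_derive_tonem rho t :
  is_derive t 1 (fun x : R => x * (1 - x) / rho) ((1 - 2 * t) / rho).
Proof.
have d := is_deriveM (is_derive_id t 1) (is_derive_onem t).
have d2 := is_deriveM d (is_derive_cst (rho^-1) t 1).
apply: is_derive_eq d2 _; rewrite /GRing.scale /=; ring.
Qed.

(** The end point 1/4 keeps t below 1/2, where t (1 - t) increases, and keeps 1 - 2 t away from
    0. *)
Lemma transported_subst a h rho e : 0 < rho -> 0 < e <= 4^-1 -> continuous h ->
  (\int[mu]_(u in `[(e * (1 - e) / rho)%R, (4^-1 * (1 - 4^-1) / rho)%R]) (transported a h u)%:E =
   \int[mu]_(t in `[e, 4^-1%R])
     (transported a h (t * (1 - t) / rho) * ((1 - 2 * t) / rho))%:E)%E.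
Proof.
move=> r0 /andP[e0 e4] ch.
pose F x : R := x * (1 - x) / rho.
have cF x : {for x, continuous F} by exact: is_derive1_continuous (is_derive_tonem rho x).
have F'E : F^`() = fun t => (1 - 2 * t) / rho.
  by apply/funext => t; rewrite derive1E; exact: (@derive_val _ _ _ _ _ _ _ (is_derive_tonem rho t)).
have cF' x : {for x, continuous (fun t => (1 - 2 * t) / rho)}.
  apply: cvgMl; apply: cvgB; first exact: cvg_cst.
  by apply: cvgMr; exact: cvg_id.
rewrite -/(F e) -/(F 4^-1) (@integration_by_substitution_increasing _ F)//.
- by apply: eq_integral => t _; rewrite F'E.
- move=> x y; rewrite !in_itv /= => /andP[x1 x2] /andP[y1 y2] xy.
  rewrite /F ltr_pM2r ?invr_gt0//; nra.
- by rewrite F'E => x _; exact: cF'.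
- by rewrite F'E; apply/cvg_ex; eexists; apply: cvg_at_right_filter; exact: cF'.
- by rewrite F'E; apply/cvg_ex; eexists; apply: cvg_at_left_filter; exact: cF'.
- split.
  + by move=> x _; have [] := is_derive_tonem rho x.
  + by apply: cvg_at_right_filter; exact: cF.
  + by apply: cvg_at_left_filter; exact: cF.
- apply: continuous_within => u /andP[u1 u2]; apply: transported_continuous => //.
  apply: lt_le_trans u1; rewrite /F divr_gt0// mulr_gt0//; lra.
Qed.

(** The absolute value covers both signs of the exponent; the use is for (1 - t)^(a - b), whose
    exponent has no definite sign. *)
Lemma powR_half_itv (s c : R) : 2^-1 <= s <= 1 ->
  2 `^ (- `|c|) <= s `^ c <= 2 `^ `|c|.
Proof.
move=> /andP[s2 s1]; have s0 : 0 < s by lra.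
have c1 : c <= `|c| := ler_norm c.
have c2 : - c <= `|c| by rewrite -normrN; exact: ler_norm.
apply/andP; split.
  apply: (@le_trans _ _ (s `^ `|c|)); last by apply: ger_powR; rewrite ?s0.
  rewrite powRN -powR_inv1 ?powR_ge0// powRAC powR_inv1//.
  by apply: ge0_ler_powR; rewrite ?nnegrE ?(ltW s0).
apply: (@le_trans _ _ (s `^ (- `|c|))).
  by apply: ger_powR; rewrite ?s0//; lra.
rewrite powRN -[leLHS]powR_inv1 ?powR_ge0// powRAC powR_inv1 ?(ltW s0)//.
apply: ge0_ler_powR; rewrite ?nnegrE ?invr_ge0 ?(ltW s0)//.
by rewrite invf_ple ?posrE.
Qed.

(* With u = t (1 - t) / rho the integrand becomes transported a h u, up to the factor rho^a and to
   factors bounded away from 0 and infinity on ]0, 1/4]. *)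
Lemma scaled_integrandE a b h rho t : 0 < rho -> 0 < t <= 4^-1 ->
  rho `^ a * (transported a h (t * (1 - t) / rho) * ((1 - 2 * t) / rho)) =
  scaled_integrand a b h rho t * ((1 - t) `^ (a - b) * (1 - 2 * t)).
Proof.
move=> r0 /andP[t0 t4]; have t1 : 0 < 1 - t by lra.
rewrite /transported /scaled_integrand /beta_weight invf_div.
have rD x y (z : R) : 0 < z -> z `^ x * z `^ y = z `^ (x + y).
  by move=> z0; rewrite powRD// (gt_eqF z0) implybT.
have e1 : rho `^ a * rho^-1 `^ (a - 1) * rho^-1 = 1.
  rewrite -(powR_inv1 (ltW r0)) -powRrM !rD// (_ : a + -1 * (a - 1) + -1 = 0) ?powRr0//; ring.
have e2 : (1 - t) `^ (b - 1) * (1 - t) `^ (a - b) = (1 - t) `^ (a - 1).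
  by rewrite rD//; congr powR; ring.
rewrite powRM ?mulr_ge0 ?invr_ge0 ?(ltW r0) ?(ltW t0) ?(ltW t1)//.
rewrite powRM ?(ltW t0) ?(ltW t1)// -e2.
transitivity ((rho `^ a * rho^-1 `^ (a - 1) * rho^-1) * (t `^ (a - 1) * (1 - t) `^ (b - 1) *
  h (rho / (t * (1 - t))) * ((1 - t) `^ (a - b) * (1 - 2 * t)))); first by ring.
by rewrite e1 mul1r.
Qed.

Lemma measurable_inv : measurable_fun setT (fun x : R => x^-1).
Proof.
(* The square is nonnegative, so its power -1 is a true inverse; at x = 0 both sides are 0 by the
   convention 0^-1 = 0. *)
rewrite (_ : (fun x : R => x^-1) = fun x => x * (x ^+ 2) `^ (-1)).
  apply: measurable_funM => //.
  apply: (@measurableT_comp _ _ _ _ _ _ (fun x => x `^ (-1))); first exact: measurable_powR.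
  exact: measurable_funX.
apply/funext => x; rewrite powR_inv1 ?sqr_ge0//.
have [->|x0] := eqVneq x 0; first by rewrite invr0 mul0r.
by field.
Qed.

Lemma measurable_scaled_integrand a b h rho : continuous h ->
  measurable_fun setT (scaled_integrand a b h rho).
Proof.
move=> ch; apply: measurable_funM; first exact: measurable_beta_weight.
apply: measurableT_comp; first exact: continuous_measurable_fun.
apply: measurable_funM; first exact: measurable_cst.
apply: (measurableT_comp measurable_inv).
by apply: measurable_funM => //; apply: measurable_funB.
Qed.

Lemma measurable_transported a h : continuous h ->
  measurable_fun setT (transported a h).
Proof.
move=> ch; apply: measurable_funM; first exact: measurable_powR.
by apply: measurableT_comp measurable_inv; exact: continuous_measurable_fun.
Qed.

Lemma scaled_integrand_ge0 a b h rho t : (forall s, 0 <= h s) ->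
  0 <= scaled_integrand a b h rho t.
Proof. by move=> h0; rewrite mulr_ge0 ?beta_weight_ge0. Qed.

Lemma transported_ge0 a h u : (forall s, 0 <= h s) -> 0 <= transported a h u.
Proof. by move=> h0; rewrite mulr_ge0 ?powR_ge0. Qed.

(** Put k = 2^|a - b|. On ]0, 1/4] the factor (1 - t)^(a - b) lies in [1/k, k] and 1 - 2 t in
    [1/2, 1]. Passing from rho to u costs 2 k, and returning from u at rho = 1/2 costs k /
    (1/2)^a. *)
Definition scaling_const a b : R :=
  2 * 2 `^ `|a - b| * (2^-1 `^ a)^-1 * 2 `^ `|a - b|.

Lemma scaling_const_ge0 a b : 0 <= scaling_const a b.
Proof. by rewrite !mulr_ge0 ?invr_ge0 ?powR_ge0. Qed.

(** In the variable u both sides integrate [transported a h], and the factor rho^a is at most 1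
    because 0 < a. The range of u for rho lies inside the range for 1/2, except where h (1 / u) =
    0. *)
Lemma scaled_integral_left_le a b h rho e : 0 < a -> continuous h -> (forall s, 0 <= h s) ->
  (forall s, 0 <= s <= 6 -> h s = 0) -> 0 < rho < 1 -> 0 < e < 1 ->
  (\int[mu]_(t in `[e, 4^-1%R]) (scaled_integrand a b h rho t)%:E <=
   (scaling_const a b)%:E *
   \int[mu]_(t in `[(e * (1 - e) / 2)%R, 4^-1%R]) (scaled_integrand a b h 2^-1 t)%:E)%E.
Proof.
move=> a0 ch h0 h6 /andP[r0 r1] /andP[e0 e1].
have [e4|e4] := leP e 4^-1; last first.
  rewrite set_itv_ge ?integral_set0; last by rewrite bnd_simp -ltNge.
  rewrite mule_ge0 ?lee_fin ?scaling_const_ge0//.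
  by apply: integral_ge0 => t _; rewrite lee_fin scaled_integrand_ge0.
pose k : R := 2 `^ `|a - b|; pose T r t : R := transported a h (t * (1 - t) / r) * ((1 - 2 * t) / r).
pose q t : R := (1 - t) `^ (a - b) * (1 - 2 * t).
have k0 : 0 < k by rewrite powR_gt0.
have q_itv t : 0 < t <= 4^-1 -> (2 * k)^-1 <= q t <= k.
  move=> /andP[t0 t4].
  have /(powR_half_itv (a - b)) /andP[q1 q2] : 2^-1 <= 1 - t <= 1 by apply/andP; split; lra.
  rewrite -/k powRN -/k in q1 q2.
  have kV : 0 < k^-1 by rewrite invr_gt0.
  by rewrite /q invfM; apply/andP; split; nra.
have TE r t : 0 < r -> 0 < t <= 4^-1 -> r `^ a * T r t = scaled_integrand a b h r t * q t.
  exact: scaled_integrandE.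
have T_ge0 r t : 0 < r -> 0 < t <= 4^-1 -> 0 <= T r t.
  move=> rp /andP[t0 t4]; rewrite mulr_ge0 ?transported_ge0// divr_ge0 ?(ltW rp)//; lra.
have mT r : measurable_fun setT (T r).
  apply: measurable_funM.
    apply: measurableT_comp; first exact: measurable_transported.
    apply: measurable_funM => //; apply: measurable_funM => //; exact: measurable_funB.
  by apply: measurable_funM => //; apply: measurable_funB => //; apply: measurable_funM.
have step1 t : 0 < t <= 4^-1 -> scaled_integrand a b h rho t <= 2 * k * T rho t.
  move=> t4; have := TE _ _ r0 t4; have /andP[q1 q2] := q_itv _ t4.
  have := scaled_integrand_ge0 a b rho t h0; have := T_ge0 _ _ r0 t4.
  have ra : rho `^ a <= 1.
    apply: (@le_trans _ _ (1 `^ a)); last by rewrite powR1.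
    by apply: ge0_ler_powR; rewrite ?nnegrE ?(ltW r0) ?(ltW a0) ?(ltW r1).
  have k2 : 0 < 2 * k by rewrite mulr_gt0.
  move: (scaled_integrand _ _ _ _ _) (T _ _) (rho `^ a) ra => s T' p p1 T0 s0 E.
  have E2 : s * (2 * k)^-1 <= T'.
    apply: (@le_trans _ _ (s * q t)); first exact: ler_wpM2l.
    by rewrite -E; apply: ler_piMl.
  by rewrite mulrC -ler_pdivrMr.
have h2 : (0 : R) < 2^-1 by rewrite invr_gt0.
have step2 t : 0 < t <= 4^-1 -> T 2^-1 t <= (2^-1 `^ a)^-1 * k * scaled_integrand a b h 2^-1 t.
  move=> t4; have := TE _ _ h2 t4; have /andP[q1 q2] := q_itv _ t4.
  have := scaled_integrand_ge0 a b 2^-1 t h0.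
  have p0 : 0 < 2^-1 `^ a :> R by rewrite powR_gt0.
  move: (scaled_integrand _ _ _ _ _) (T _ _) (2^-1 `^ a) p0 => s T' p p0 s0 E.
  rewrite -mulrA mulrC ler_pdivlMr// mulrC E mulrC; exact: ler_wpM2r.
(* This choice gives 2 e' (1 - e') <= e (1 - e) / rho: the range of u for 1/2 starts below the one
   for rho. *)
pose e' := e * (1 - e) / 2.
have e'0 : 0 < e' by rewrite /e' divr_gt0// mulr_gt0// subr_gt0.
have e'4 : e' <= 4^-1 by rewrite /e'; nra.
apply: (@le_trans _ _ (\int[mu]_(t in `[e, 4^-1%R]) ((2 * k)%:E * (T rho t)%:E))%E).
  apply: ge0_le_integral => //.
  - by move=> t _; rewrite lee_fin scaled_integrand_ge0.
  - by apply/measurable_EFinP/measurable_funTS; exact: measurable_scaled_integrand.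
  - apply: measurable_funeM; apply/measurable_EFinP; exact: measurable_funTS (mT _).
  - move=> t /=; rewrite in_itv /= => /andP[t1 t2]; rewrite lee_fin step1// t2 andbT.
    exact: lt_le_trans t1.
rewrite ge0_integralZl_EFin//; first last.
- by rewrite mulr_ge0// ltW.
- by apply/measurable_EFinP; exact: measurable_funTS (mT _).
- move=> t /=; rewrite in_itv /= => /andP[t1 t2]; rewrite lee_fin T_ge0// t2 andbT.
  exact: lt_le_trans t1.
rewrite -transported_subst//; last by rewrite e0.
have -> : scaling_const a b = (2 * k) * ((2^-1 `^ a)^-1 * k) by rewrite /scaling_const -!mulrA.
rewrite (EFinM (2 * k)) -muleA; apply: lee_wpmul2l; first by rewrite lee_fin mulr_ge0 ?(ltW k0).
apply: (@le_trans _ _ (\int[mu]_(t in `[e', 4^-1%R]) (T 2^-1 t)%:E)%E); last first.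
  rewrite -ge0_integralZl_EFin//; first last.
  - by rewrite mulr_ge0 ?invr_ge0 ?powR_ge0// ltW.
  - by apply/measurable_EFinP/measurable_funTS; exact: measurable_scaled_integrand.
  - by move=> t _; rewrite lee_fin scaled_integrand_ge0.
  apply: ge0_le_integral => //.
  - move=> t /=; rewrite in_itv /= => /andP[t1 t2]; rewrite lee_fin T_ge0// t2 andbT.
    exact: lt_le_trans t1.
  - apply/measurable_EFinP; exact: measurable_funTS (mT _).
  - apply: measurable_funeM; apply/measurable_EFinP/measurable_funTS.
    exact: measurable_scaled_integrand.
  - move=> t /=; rewrite in_itv /= => /andP[t1 t2]; rewrite lee_fin step2// t2 andbT.
    exact: lt_le_trans t1.
rewrite -transported_subst ?e'0//.
rewrite [leLHS]integral_mkcond [leRHS]integral_mkcond; apply: ge0_le_integral => //.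
- by move=> u _; rewrite patchE; case: ifP => // _; rewrite lee_fin transported_ge0.
- apply/(measurable_restrictT _ _).1 => //.
  by apply/measurable_EFinP/measurable_funTS; exact: measurable_transported.
- apply/(measurable_restrictT _ _).1 => //.
  by apply/measurable_EFinP/measurable_funTS; exact: measurable_transported.
- move=> u _; rewrite !patchE; case: ifPn => [|_]; last first.
    by case: ifP => // _; rewrite lee_fin transported_ge0.
  rewrite inE /= in_itv /= => /andP[u1 u2]; case: ifPn => //.
  rewrite notin_setE /= in_itv /= => /negP; rewrite negb_and -!ltNge => /orP[u3|u3].
    exfalso; move: u3; apply/negP; rewrite -leNgt; apply: le_trans u1.
    rewrite invrK /e' ler_pdivlMr//.
    have : 0 < e * (1 - e) by rewrite mulr_gt0// subr_gt0.
    move: (e * (1 - e)) => m m0; have mr : m * rho <= m by rewrite ler_piMr// ltW.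
    have mr0 : 0 <= m * rho by rewrite mulr_ge0// ltW.
    by rewrite (_ : _ * rho = m * rho * (1 - m / 2)); [nra|field].
  (* Past 3/8, the upper end of the range for rho = 1/2, the argument 1 / u is below 8/3, where h
     vanishes. *)
  rewrite lee_fin /transported h6 ?mulr0//.
  have u0 : 0 < u by apply: lt_trans u3; rewrite divr_gt0//; lra.
  rewrite invr_ge0 (ltW u0)/= invf_ple ?posrE//; apply/ltW; apply: le_lt_trans u3.
  by rewrite invrK; lra.
Qed.

Lemma scaled_integrand_onem a b h rho t :
  scaled_integrand a b h rho (1 - t) = scaled_integrand b a h rho t.
Proof.
by rewrite /scaled_integrand /beta_weight subKr [(1 - t) * t]mulrC [_ * t `^ _]mulrC.
Qed.

Lemma scaled_integrand_continuous a b h rho t : continuous h -> 0 < t < 1 ->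
  {for t, continuous (scaled_integrand a b h rho)}.
Proof.
move=> ch /andP[t0 t1]; have t1' : 0 < 1 - t by rewrite subr_gt0.
have c1 : {for t, continuous (beta_weight a b)}.
  apply: cvgM; first exact: is_derive1_continuous (is_derive1_powR _ t0).
  exact: is_derive1_continuous (is_derive_onem_powR _ t1').
apply: cvgM => //.
have c2 : {for t, continuous (fun x : R => rho / (x * (1 - x)))}.
  apply: cvgMr; apply: cvgV; first by rewrite gt_eqF// mulr_gt0.
  by apply: cvgM; [exact: cvg_id|apply: cvgB; [exact: cvg_cst|exact: cvg_id]].
exact: (continuous_comp c2 (ch _)).
Qed.

Lemma scaled_integral_reflect a b h rho e : continuous h -> 0 < e <= 4^-1 ->
  (\int[mu]_(t in `[(1 - 4^-1)%R, (1 - e)%R]) (scaled_integrand a b h rho t)%:E =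
   \int[mu]_(t in `[e, 4^-1%R]) (scaled_integrand b a h rho t)%:E)%E.
Proof.
move=> ch /andP[e0 e4]; pose F x : R := 1 - x.
have cF x : {for x, continuous F} by exact: is_derive1_continuous (is_derive_onem x).
have F'E : F^`() = cst (-1).
  by apply/funext => t; rewrite derive1E; exact: (@derive_val _ _ _ _ _ _ _ (is_derive_onem t)).
rewrite -/(F e) -/(F 4^-1) (@integration_by_substitution_decreasing _ F)//.
- by apply: eq_integral => t _; rewrite F'E -scaled_integrand_onem /= fctE opprK mulr1.
- by move=> x y _ _ xy; rewrite /F ler_ltB.
- by rewrite F'E => x _; exact: cvg_cst.
- by rewrite F'E; exact: is_cvg_cst.
- by rewrite F'E; exact: is_cvg_cst.
- split.
  + by move=> x _; have [] := is_derive_onem x.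
  + by apply: cvg_at_right_filter; exact: cF.
  + by apply: cvg_at_left_filter; exact: cF.
- apply: continuous_within => u /andP[u1 u2]; apply: scaled_integrand_continuous => //.
  by rewrite /F in u1 u2; apply/andP; split; lra.
Qed.

Lemma scaled_integral_right_le a b h rho e : 0 < b -> continuous h -> (forall s, 0 <= h s) ->
  (forall s, 0 <= s <= 6 -> h s = 0) -> 0 < rho < 1 -> 0 < e < 1 ->
  (\int[mu]_(t in `[(1 - 4^-1)%R, (1 - e)%R]) (scaled_integrand a b h rho t)%:E <=
   (scaling_const b a)%:E *
   \int[mu]_(t in `[(1 - 4^-1)%R, (1 - e * (1 - e) / 2)%R]) (scaled_integrand a b h 2^-1 t)%:E)%E.
Proof.
move=> b0 ch h0 h6 r01 /andP[e0 e1].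
have [e4|e4] := leP e 4^-1; last first.
  rewrite set_itv_ge ?integral_set0; last by rewrite bnd_simp -ltNge; lra.
  rewrite mule_ge0 ?lee_fin ?scaling_const_ge0//.
  by apply: integral_ge0 => t _; rewrite lee_fin scaled_integrand_ge0.
rewrite !scaled_integral_reflect ?e0//.
  by apply: scaled_integral_left_le => //; rewrite e0.
by apply/andP; split; [rewrite divr_gt0// mulr_gt0// subr_gt0|nra].
Qed.

Lemma scaled_integral_bounded a b f : 0 < a -> 0 < b -> continuous f -> (forall s, 0 <= f s) ->
  mu.-integrable I01 (EFin \o scaled_integrand a b f 2^-1) ->
  exists C : R, forall rho, 0 < rho < 1 ->
    (\int[mu]_(t in I01) (scaled_integrand a b f rho t)%:E <= C%:E)%E.
Proof.
move=> a0 b0 cf f0 if2.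
have [c c06 fM] : exists2 c : R, c \in `[0, 6]%R & forall t, t \in `[0, 6]%R -> f t <= f c.
  by apply: EVT_max => //; exact: continuous_subspaceT.
(* Twice the positive part of f - M, in a form that is visibly continuous. It vanishes on [0, 6],
   satisfies f <= M + h, and h <= 2 f makes it integrable at rho = 1/2. *)
pose M := f c; pose h s := `|f s - M| + (f s - M).
have ch : continuous h.
  move=> s; have d : {for s, continuous (fun s => f s - M)}.
    by apply: cvgB; [exact: cf|exact: cvg_cst].
  by apply: cvgD => //; exact: cvg_norm.
have h0 s : 0 <= h s by rewrite /h -[X in _ + X]opprK subr_ge0 -normrN ler_norm.
have h6 s : 0 <= s <= 6 -> h s = 0.
  move=> s6; have : f s <= M by apply: fM; rewrite in_itv.
  by move=> fs; rewrite /h ler0_norm ?subr_le0// addNr.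
have fh s : f s <= M + h s by rewrite /h; have := normr_ge0 (f s - M); lra.
have M0 : 0 <= M by exact: f0.
have hf s : h s <= 2 * f s.
  by rewrite /h; have := f0 s; have [q|q] := lerP 0 (f s - M); rewrite ?(ger0_norm q) ?(ltr0_norm q); lra.
have mh a' b' rho : measurable_fun setT (scaled_integrand a' b' h rho).
  exact: measurable_scaled_integrand.
have mf rho : measurable_fun setT (scaled_integrand a b f rho).
  exact: measurable_scaled_integrand.
have sh0 a' b' rho t : 0 <= scaled_integrand a' b' h rho t by exact: scaled_integrand_ge0.
pose H := (\int[mu]_(t in I01) (scaled_integrand a b h 2^-1 t)%:E)%E.
have Hfin : (H < +oo)%E.
  apply: (@le_lt_trans _ _ (\int[mu]_(t in I01) (2%:E * (scaled_integrand a b f 2^-1 t)%:E))%E).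
    apply: ge0_le_integral => //.
    - by move=> t _; rewrite lee_fin.
    - by apply/measurable_EFinP; exact: measurable_funTS (mh _ _ _).
    - by apply: measurable_funeM; apply/measurable_EFinP; exact: measurable_funTS (mf _).
    - move=> t _; rewrite lee_fin /scaled_integrand mulrCA ler_wpM2l ?beta_weight_ge0//.
  rewrite ge0_integralZl_EFin//.
  - apply: lte_mul_pinfty => //.
    have fin : (\int[mu]_(t in I01) (scaled_integrand a b f 2^-1 t)%:E)%E \is a fin_num.
      exact: integrable_fin_num if2.
    by rewrite ltey_eq fin.
  - by move=> t _; rewrite lee_fin scaled_integrand_ge0.
  - by apply/measurable_EFinP; apply: measurable_funTS; first [exact: mh|exact: mf].
have H0 : (0 <= H)%E by apply: integral_ge0 => t _; rewrite lee_fin.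
have HE : H = (fine H)%:E by rewrite fineK// ge0_fin_numE.
have Hsub (A : set R) : measurable A -> A `<=` I01 ->
    (\int[mu]_(t in A) (scaled_integrand a b h 2^-1 t)%:E <= (fine H)%:E)%E.
  move=> mA AI; rewrite -HE; apply: ge0_subset_integral => //.
    by apply/measurable_EFinP; apply: measurable_funTS; first [exact: mh|exact: mf].
  by move=> t _; rewrite lee_fin.
pose Ch := scaling_const a b * fine H + scaling_const b a * fine H.
have hbound rho : 0 < rho < 1 ->
    (\int[mu]_(t in I01) (scaled_integrand a b h rho t)%:E <= Ch%:E)%E.
  move=> r01; apply: integral_exhaust01_le => // n.
  have /andP[] := @invn3_itv R n; set e : R := n.+3%:R^-1 => e0 e2.
  pose g t := (scaled_integrand a b h rho t)%:E.
  pose A : set R := `[e, 4^-1]; pose B : set R := `[1 - 4^-1, 1 - e].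
  have mA : measurable A by exact: measurable_itv.
  have mB : measurable B by exact: measurable_itv.
  have mE : measurable (exhaust01 n : set R) by exact: measurable_itv.
  have mg D : measurable_fun D g by apply/measurable_EFinP; apply: measurable_funTS; first [exact: mh|exact: mf].
  have g0 t : (0 <= g t)%E by rewrite lee_fin.
  have e01 : 0 < e < 1 by apply/andP; split; lra.
  have e'0 : 0 < e * (1 - e) by apply: mulr_gt0; lra.
  have e'1 : e * (1 - e) < 1 by nra.
  rewrite (_ : (\int[mu]_(t in exhaust01 n) (scaled_integrand a b h rho t)%:E)%E =
    (\int[mu]_(t in exhaust01 n) ((g \_ A) t + (g \_ B) t))%E); last first.
    apply: eq_integral => t; rewrite inE /exhaust01 /= in_itv /= -/e => /andP[t1 t2].
    rewrite !patchE /A /B.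
    have [tA|tA] := boolP (t \in _); have [tB|tB] := boolP (t \in _).
    - move: tA tB; rewrite !inE /= !in_itv /= => /andP[_ p1] /andP[p2 _]; exfalso; lra.
    - by rewrite adde0.
    - by rewrite add0e.
    (* Between the two end pieces t (1 - t) > 3/16, so rho / (t (1 - t)) < 16/3 < 6 and h
       vanishes. *)
    - rewrite adde0 /scaled_integrand h6 ?mulr0//.
      move: tA tB; rewrite !notin_setE /= !in_itv /= t1 t2 andbT /=.
      move=> /negP; rewrite -ltNge => p1 /negP; rewrite -ltNge => p2.
      have p3 : 0 < t * (1 - t) by apply: mulr_gt0; lra.
      have /andP[r0 r1] := r01.
      rewrite divr_ge0 ?(ltW r0) ?(ltW p3)//= ler_pdivrMr//; nra.
  rewrite ge0_integralD//; first last.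
  - by apply/measurable_restrict => //; exact: mg.
  - by move=> t _; rewrite patchE; case: ifP.
  - by apply/measurable_restrict => //; exact: mg.
  - by move=> t _; rewrite patchE; case: ifP.
  rewrite -!integral_mkcondr /Ch EFinD; apply: leeD.
    apply: (@le_trans _ _ (\int[mu]_(t in A) g t)%E).
      apply: ge0_subset_integral; [exact: measurableI|exact: mA|exact: mg| |exact: subIsetr].
      by move=> t _; exact: g0.
    apply: (le_trans (scaled_integral_left_le _ a0 ch h0 h6 r01 e01)).
    rewrite (EFinM (scaling_const a b)); apply: lee_wpmul2l; first by rewrite lee_fin scaling_const_ge0.
    apply: Hsub => //.
    by move=> t /=; rewrite !in_itv /= => /andP[t1 t2]; apply/andP; split; lra.
  apply: (@le_trans _ _ (\int[mu]_(t in B) g t)%E).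
    apply: ge0_subset_integral; [exact: measurableI|exact: mB|exact: mg| |exact: subIsetr].
    by move=> t _; exact: g0.
  apply: (le_trans (scaled_integral_right_le _ b0 ch h0 h6 r01 e01)).
  rewrite (EFinM (scaling_const b a)); apply: lee_wpmul2l; first by rewrite lee_fin scaling_const_ge0.
  apply: Hsub => //.
  by move=> t /=; rewrite !in_itv /= => /andP[t1 t2]; apply/andP; split; lra.
have ibw := beta_weight_integrable a0 b0.
pose W := \int[mu]_(t in I01) beta_weight a b t.
have WE : (\int[mu]_(t in I01) (beta_weight a b t)%:E = W%:E)%E.
  by rewrite /W fineK//; exact: integrable_fin_num.
exists (M * W + Ch) => rho r01.
apply: (@le_trans _ _ (\int[mu]_(t in I01)
   (M%:E * (beta_weight a b t)%:E + (scaled_integrand a b h rho t)%:E))%E).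
  apply: ge0_le_integral => //.
  - by move=> t _; rewrite lee_fin scaled_integrand_ge0.
  - by apply/measurable_EFinP; apply: measurable_funTS; first [exact: mh|exact: mf].
  - apply: emeasurable_funD; last by apply/measurable_EFinP; apply: measurable_funTS; first [exact: mh|exact: mf].
    apply: measurable_funeM; apply/measurable_EFinP; apply: measurable_funTS; exact: measurable_beta_weight.
  - move=> t _; rewrite -EFinM -EFinD lee_fin /scaled_integrand mulrC [M * _]mulrC -mulrDr mulrC.
    by rewrite ler_wpM2l ?beta_weight_ge0.
rewrite ge0_integralD//; first last.
- by apply/measurable_EFinP; apply: measurable_funTS; first [exact: mh|exact: mf].
- by move=> t _; rewrite lee_fin.
- apply: measurable_funeM; apply/measurable_EFinP; apply: measurable_funTS; exact: measurable_beta_weight.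
- by move=> t _; rewrite mule_ge0// lee_fin// beta_weight_ge0.
rewrite ge0_integralZl_EFin//; first last.
- by apply/measurable_EFinP/measurable_funTS; exact: measurable_beta_weight.
- by move=> t _; rewrite lee_fin beta_weight_ge0.
by rewrite WE EFinD EFinM; apply: leeD => //; exact: hbound.
Qed.

End UniformBound.

(** * Fubini's theorem on the unit square *)

Section Fubini01.
Local Open Scope classical_set_scope.
Context {R : realType}.
Local Notation Re := complex.Re.
Local Notation Im := complex.Im.
Local Notation normc := Normc.normc.
Local Notation mu := (@lebesgue_measure R).
Local Notation I01 := (`]0%R, 1%R[%classic : set R).

Lemma integral_square_l (H : R * R -> \bar R) (x : R) :
  (\int[mu]_y (H \_ (I01 `*` I01)) (x, y) =
   ((fun x => \int[mu]_(y in I01) H (x, y)) \_ I01) x)%E.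
Proof.
rewrite [RHS]patchE; case: ifPn => xI.
  rewrite [RHS]integral_mkcond; apply: eq_integral => y _.
  rewrite !patchE; congr (if _ then _ else _).
  by rewrite in_setX xI.
by apply: integral0_eq => y _; rewrite patchE in_setX (negbTE xI).
Qed.

Lemma integral_square_r (H : R * R -> \bar R) (y : R) :
  (\int[mu]_x (H \_ (I01 `*` I01)) (x, y) =
   ((fun y => \int[mu]_(x in I01) H (x, y)) \_ I01) y)%E.
Proof.
rewrite [RHS]patchE; case: ifPn => yI.
  rewrite [RHS]integral_mkcond; apply: eq_integral => x _.
  rewrite !patchE; congr (if _ then _ else _).
  by rewrite in_setX yI andbT.
by apply: integral0_eq => x _; rewrite patchE in_setX (negbTE yI) andbF.
Qed.

(** The majorant phi of the inner absolute integrals yields joint integrability by Tonelli. Sections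
    are integrable at every point, not just almost everywhere, so that the real-valued inner
    integrals agree with the extended ones throughout ]0, 1[. *)
Lemma Fubini01 (g : R * R -> R) (phi : R -> R) : measurable_fun setT g ->
  mu.-integrable I01 (EFin \o phi) ->
  (forall x, I01 x -> (\int[mu]_(y in I01) `|g (x, y)|%:E <= (phi x)%:E)%E) ->
  (forall y, I01 y -> mu.-integrable I01 (fun x => (g (x, y))%:E)) ->
  [/\ mu.-integrable I01 (EFin \o (fun x => \int[mu]_(y in I01) g (x, y))),
      mu.-integrable I01 (EFin \o (fun y => \int[mu]_(x in I01) g (x, y)))
    & \int[mu]_(x in I01) \int[mu]_(y in I01) g (x, y) =
      \int[mu]_(y in I01) \int[mu]_(x in I01) g (x, y)].
Proof.
move=> mg iphi gphi ig.
pose G := (EFin \o g) \_ (I01 `*` I01).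
have mG : measurable_fun setT G.
  apply/(measurable_restrictT _ _).1; first exact: measurableX.
  by apply: measurable_funTS; apply/measurable_EFinP.
have mgx x : measurable_fun I01 (fun y => (g (x, y))%:E).
  apply/measurable_EFinP/measurable_funTS.
  by apply: measurableT_comp => //; exact: measurable_pair1.
have absG : abse \o G = (EFin \o (fun p => `|g p|)) \_ (I01 `*` I01).
  by apply/funext => p; rewrite /= /G !patchE; case: ifP => // _; rewrite abse0.
have mabs : measurable_fun setT (fun x => \int[mu]_y (abse \o G) (x, y))%E.
  apply: (@measurable_fun_fubini_tonelli_F _ _ _ _ R mu (abse \o G)).
    exact: measurableT_comp mG.
  by move=> p; exact: abse_ge0.
have iG : (mu \x mu)%E.-integrable setT G.
  apply: (proj2 (@integrable12ltyP _ _ _ _ R mu mu G mG)).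
  apply: (@le_lt_trans _ _ (\int[mu]_x (`|((EFin \o phi) \_ I01) x|)))%E.
    apply: ge0_le_integral => //.
    - by move=> x _; apply: integral_ge0.
    - have mphi : measurable_fun setT ((EFin \o phi) \_ I01).
        by apply/(measurable_restrictT _ _).1 => //; exact: measurable_int iphi.
      exact: measurableT_comp mphi.
    - move=> x _; have -> : (\int[mu]_y `|G (x, y)| = \int[mu]_y (abse \o G) (x, y))%E by [].
      rewrite absG integral_square_l !patchE; case: ifPn => xI; last by rewrite abse0.
      rewrite inE in xI; apply: (le_trans (gphi _ xI)).
      by rewrite lee_fin ler_norm.
  have /(integrable_restrict mu) : mu.-integrable (setT `&` I01) (EFin \o phi) by rewrite setTI.
  by move=> /(_ (measurable_itv _) measurableT) /integrableP[].
have FE : fubini_F mu G = (fun x => \int[mu]_(y in I01) (g (x, y))%:E)%E \_ I01.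
  by apply/funext => x; exact: integral_square_l.
have GE : fubini_G mu G = (fun y => \int[mu]_(x in I01) (g (x, y))%:E)%E \_ I01.
  by apply/funext => y; exact: integral_square_r.
have igx x : I01 x -> mu.-integrable I01 (fun y => (g (x, y))%:E).
  move=> xI; apply/integrableP; split; first exact: mgx.
  exact: le_lt_trans (gphi _ xI) (ltry _).
have Ffin x : I01 x -> (\int[mu]_(y in I01) g (x, y))%:E = (\int[mu]_(y in I01) (g (x, y))%:E)%E.
  by move=> xI; rewrite fineK//; exact: integrable_fin_num (igx _ xI).
have Gfin y : I01 y -> (\int[mu]_(x in I01) g (x, y))%:E = (\int[mu]_(x in I01) (g (x, y))%:E)%E.
  by move=> yI; rewrite fineK//; exact: integrable_fin_num (ig _ yI).
have iF := integrable_fubini_F iG.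
have iGG : mu.-integrable setT (fubini_G mu G).
  (* Integrability of [fubini_G] is that of [fubini_F] for the function with its arguments
     exchanged. *)
  pose G' (p : R * R) := G (p.2, p.1).
  have mG' : measurable_fun setT G' by apply: measurableT_comp mG _; exact: measurable_swap.
  have iG' : (mu \x mu)%E.-integrable setT G'.
    apply: (proj2 (@integrable12ltyP _ _ _ _ R mu mu G' mG')).
    exact: (proj1 (@integrable21ltyP _ _ _ _ R mu mu G mG)).
  exact: (integrable_fubini_F iG').
split.
- have {}iF : mu.-integrable setT (fubini_F mu G) := iF.
  move: iF; rewrite FE => /(integrable_restrict mu (measurable_itv _) measurableT).
  rewrite setTI; apply: eq_integrable => // x /set_mem xI /=; by rewrite Ffin.
- move: iGG; rewrite GE => /(integrable_restrict mu (measurable_itv _) measurableT).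
  rewrite setTI; apply: eq_integrable => // y /set_mem yI /=; by rewrite Gfin.
have := Fubini iG.
rewrite -/(fubini_F mu G) -/(fubini_G mu G).
have -> : (\int[mu]_x \int[mu]_y G (x, y) = \int[mu]_x (fubini_F mu G x))%E by [].
have -> : (\int[mu]_y \int[mu]_x G (x, y) = \int[mu]_y (fubini_G mu G y))%E by [].
rewrite FE GE -!integral_mkcond => FG.
have -> : \int[mu]_(x in I01) \int[mu]_(y in I01) g (x, y) =
    fine (\int[mu]_(x in I01) \int[mu]_(y in I01) (g (x, y))%:E)%E.
  by congr fine; apply: eq_integral => x /set_mem xI; rewrite Ffin.
by rewrite FG; congr fine; apply: eq_integral => y /set_mem yI; rewrite Gfin.
Qed.

Lemma CFubini01 (T : R * R -> R[i]) (phi : R -> R) : cmeasurable T ->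
  mu.-integrable I01 (EFin \o phi) ->
  (forall x, 0 < x < 1 -> (\int[mu]_(y in I01) (normc (T (x, y)))%:E <= (phi x)%:E)%E) ->
  (forall y, 0 < y < 1 -> Cintegrable01 (fun x => T (x, y))) ->
  [/\ Cintegrable01 (fun x => Cintegral01 (fun y => T (x, y))),
      Cintegrable01 (fun y => Cintegral01 (fun x => T (x, y)))
    & Cintegral01 (fun x => Cintegral01 (fun y => T (x, y))) =
      Cintegral01 (fun y => Cintegral01 (fun x => T (x, y)))].
Proof.
move=> [m1 m2] iphi Tphi iT; have mn := measurable_normc (conj m1 m2).
have dom (g : R * R -> R) : measurable_fun setT g -> (forall p, `|g p| <= normc (T p)) ->
    forall x, I01 x -> (\int[mu]_(y in I01) `|g (x, y)|%:E <= (phi x)%:E)%E.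
  move=> mg gT x /in01 x01; apply: le_trans (Tphi _ x01); apply: ge0_le_integral => //.
  - apply/measurable_EFinP/measurable_funTS; apply: measurableT_comp => //.
    by apply: measurableT_comp => //; exact: measurable_pair1.
  - apply/measurable_EFinP/measurable_funTS.
    by apply: (measurableT_comp mn); exact: measurable_pair1.
  - by move=> y _; rewrite lee_fin.
have [|i1 i2 e1] := Fubini01 m1 iphi (dom _ m1 (fun p => normRe_le _)).
  by move=> y /in01 /iT[].
have [|i3 i4 e2] := Fubini01 m2 iphi (dom _ m2 (fun p => normIm_le _)).
  by move=> y /in01 /iT[].
by split; [split; [exact: i1|exact: i3]|split; [exact: i2|exact: i4]|apply: eqcP; [exact: e1|exact: e2]].
Qed.

End Fubini01.

(** * The beta transform *)

Section BetaTransform.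
Local Open Scope classical_set_scope.
Context {R : realType}.
Local Notation Re := complex.Re.
Local Notation Im := complex.Im.
Local Notation normc := Normc.normc.
Local Notation mu := (@lebesgue_measure R).
Local Notation I01 := (`]0%R, 1%R[%classic : set R).
Variables (d : nat -> R[i]) (omega w : R[i]).
Hypotheses (homega : 0 < Re omega) (hw : 0 < Re w).
Hypothesis cvg_d : exists c : R, forall s, c <= s -> cvgn (cseries d s).

Lemma cmeasurable_entire dd (T : measurableType dd) (g : T -> R) :
  measurable_fun setT g -> cmeasurable (fun p => entire d (g p)).
Proof.
move=> mg; split.
  apply: (@measurableT_comp _ _ _ _ _ _ (fun s => Re (entire d s))) => //.
  by apply: continuous_measurable_fun; exact: Re_entire_continuous cvg_d.
apply: (@measurableT_comp _ _ _ _ _ _ (fun s => Im (entire d s))) => //.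
by apply: continuous_measurable_fun; exact: Im_entire_continuous cvg_d.
Qed.

Definition pochhammer_coef (k : nat) : R[i] :=
  d k * (pochhammer omega k / pochhammer (omega + w) k).

Lemma beta_kernel_cseries (s r : R) n : 0 < r < 1 ->
  beta_kernel omega w r * cseries d (r * s) n =
  \sum_(0 <= k < n) (d k * (s ^+ k)%:C) * beta_kernel (omega + k%:R) w r.
Proof.
move=> r01; rewrite /cseries mulr_sumr; apply: eq_bigr => k _.
have := beta_kernel_addn omega w k 0 r01; rewrite addr0 => ->.
by rewrite exprMn !rmorphM /= expr0 rmorph1; ring.
Qed.

(** Convergence of the new series is a conclusion: since 0 <= r s <= s, the partial sums are
    dominated by [majorant d s] times the beta weight, so their integrals converge, and these are
    B(omega, w) times the partial sums of the new series. *)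
Lemma beta_entire (s : R) : 0 <= s ->
  Cintegrable01 (fun r => beta_kernel omega w r * entire d (r * s)) /\
  cseries pochhammer_coef s n @[n --> \oo] -->
  ((cBeta omega w)^-1 *
    Cintegral01 (fun r => beta_kernel omega w r * entire d (r * s)) : R[i]^o).
Proof.
move=> s0.
have mser n : cmeasurable (fun r : R => cseries d (r * s) n).
  apply: cmeasurable_sum => k; apply: cmeasurableM; first exact: cmeasurable_cst.
  by apply: cmeasurable_real; apply: measurable_funX; exact: measurable_funM.
pose f_ n r : R[i] := beta_kernel omega w r * cseries d (r * s) n.
have [||||i1 c1] := @Cdominated_cvg R f_ (fun r => beta_kernel omega w r * entire d (r * s))
  (fun r => majorant d s * beta_weight (Re omega) (Re w) r).
- by move=> n; apply: cmeasurableM => //; exact: cmeasurable_beta_kernel.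
- move=> r r01; apply: cvg_complexM; first exact: cvg_cst.
  exact: cseries_cvg.
- by apply: RintegralZ_EFin; exact: beta_weight_integrable.
- move=> n r r01; rewrite Normc.normcM normc_beta_kernel// mulrC ler_wpM2r ?beta_weight_ge0//.
  apply: normc_cseries_le => //; have /andP[r0 r1] := r01.
  by rewrite mulr_ge0 ?(ltW r0)//= ler_piMl// ltW.
split; first exact: i1.
have cB : ((fun=> (cBeta omega w)^-1) n : R[i]^o) @[n --> \oo] --> ((cBeta omega w)^-1 : R[i]^o).
  exact: cvg_cst.
have cv := @cvg_complexM R (fun=> (cBeta omega w)^-1) (fun n => Cintegral01 (f_ n)) _ _ cB c1.
suff key n : (cBeta omega w)^-1 * Cintegral01 (f_ n) = cseries pochhammer_coef s n.
  exact: (@eq_seq_cvg _ _ (cseries pochhammer_coef s) _ key cv).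
have B0 := cBeta_neq0 homega hw.
have ik k : Cintegrable01 (fun r => (d k * (s ^+ k)%:C) * beta_kernel (omega + k%:R) w r).
  by apply: Cintegrable01Z; apply: beta_kernel_integrable => //; exact: Re_addn_gt0.
rewrite (eq_Cintegral01 (fun r r01 => beta_kernel_cseries s n r01)).
have [_ ->] := Cintegral01_sum n ik.
rewrite /cseries mulr_sumr; apply: eq_bigr => k _.
rewrite Cintegral01Z; last by apply: beta_kernel_integrable => //; exact: Re_addn_gt0.
rewrite -cBetaE cBeta_addn// /pochhammer_coef.
have p0 : pochhammer (omega + w) k != 0 by apply: pochhammer_neq0; rewrite cReD addr_gt0.
by move: (cBeta _ _) B0 (pochhammer (omega + w) k) p0 => B B0 P p0; field; rewrite B0 p0.
Qed.

Variables x y : R[i].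
Hypotheses (hx : 0 < Re x) (hy : 0 < Re y).
Hypothesis int_half : Cintegrable01 (fun t => beta_kernel x y t * entire d (2^-1 / (t * (1 - t)))).

(** The first coordinate is rho, the second is t. *)
Let T (p : R * R) : R[i] :=
  beta_kernel omega w p.1 * (beta_kernel x y p.2 * entire d (p.1 / (p.2 * (1 - p.2)))).

Lemma measurable_ratio : measurable_fun setT (fun p : R * R => p.1 / (p.2 * (1 - p.2))).
Proof.
apply: measurable_funM; first exact: measurable_fst.
apply: (measurableT_comp measurable_inv).
by apply: measurable_funM => //; apply: measurable_funB.
Qed.

(** The uniform bound C leaves a multiple of the beta weight as majorant in rho; the sections in rho
    at fixed t are handled by [beta_entire] with s = 1 / (t (1 - t)). *)
Lemma beta_transform_Fubini :
  [/\ Cintegrable01 (fun r => Cintegral01 (fun t => T (r, t))),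
      Cintegrable01 (fun t => Cintegral01 (fun r => T (r, t)))
    & Cintegral01 (fun r => Cintegral01 (fun t => T (r, t))) =
      Cintegral01 (fun t => Cintegral01 (fun r => T (r, t)))].
Proof.
have mT : cmeasurable T.
  apply: cmeasurableM.
    exact: cmeasurable_comp (cmeasurable_beta_kernel _ _) measurable_fst.
  apply: cmeasurableM.
    exact: cmeasurable_comp (cmeasurable_beta_kernel _ _) measurable_snd.
  exact: cmeasurable_entire measurable_ratio.
pose f s := normc (entire d s).
have cf : continuous f by exact: normc_entire_continuous.
have f0 s : 0 <= f s by exact: normc_ge0.
have normT t r : 0 < t < 1 ->
    normc (beta_kernel x y t * entire d (r / (t * (1 - t)))) = scaled_integrand (Re x) (Re y) f r t.
  by move=> t01; rewrite Normc.normcM normc_beta_kernel.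
have if2 : mu.-integrable I01 (EFin \o scaled_integrand (Re x) (Re y) f 2^-1).
  apply: eq_integrable (Cintegrable01_norm _ int_half) => //.
    by move=> t /set_mem/in01 t01; congr EFin; exact: normT.
  apply: cmeasurableM; first exact: cmeasurable_beta_kernel.
  apply: cmeasurable_entire; apply: measurable_funM => //.
  apply: (measurableT_comp measurable_inv).
  by apply: measurable_funM => //; apply: measurable_funB.
have [C hC] := scaled_integral_bounded hx hy cf f0 if2.
apply: (@CFubini01 R T (fun r => C * beta_weight (Re omega) (Re w) r)) => //.
- by apply: RintegralZ_EFin; exact: beta_weight_integrable.
- move=> r r01.
  rewrite (_ : (\int[mu]_(t in I01) (normc (T (r, t)))%:E =
    \int[mu]_(t in I01) ((beta_weight (Re omega) (Re w) r)%:E * (scaled_integrand (Re x) (Re y) f r t)%:E))%E).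
    rewrite ge0_integralZl_EFin ?beta_weight_ge0//.
    - by rewrite (mulrC C) (EFinM (beta_weight _ _ _) C); apply: lee_wpmul2l; [rewrite lee_fin beta_weight_ge0|exact: hC].
    - by move=> t _; rewrite lee_fin scaled_integrand_ge0.
    - by apply/measurable_EFinP; apply: measurable_funTS; exact: measurable_scaled_integrand.
  apply: eq_integral => t /set_mem/in01 t01.
  by rewrite -EFinM /T Normc.normcM normc_beta_kernel// normT.
- move=> t t01; have /andP[t0 t1] := t01.
  have s0 : 0 <= (t * (1 - t))^-1 by rewrite invr_ge0 mulr_ge0 ?subr_ge0 ?(ltW t0) ?(ltW t1).
  have [i1 _] := beta_entire s0.
  apply: eq_Cintegrable01 (Cintegrable01Z (beta_kernel x y t) i1) => r r01.
  by rewrite /T /=; ring.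
Qed.

End BetaTransform.

(** * The M-series as an entire series, and the beta transform formula *)

Section MSeries.
Local Open Scope classical_set_scope.
Context {R : realType}.
Local Notation Re := complex.Re.
Implicit Types (alpha beta x y omega w : R[i]) (kappa mu : seq R[i]).

(** The sign of the argument -rho / (t (1 - t)) is moved into the coefficients, which leaves a
    positive variable. *)
Definition Mcoef alpha beta kappa mu (m : nat) : R[i] :=
  (\prod_(k <- kappa) pochhammer k m) / (\prod_(u <- mu) pochhammer u m) *
  ((-1) ^+ m / cGamma (alpha * m%:R + beta)).

Lemma MBeta_argE (rho t : R) : MBeta_arg rho%:C t = - (rho / (t * (1 - t)))%:C.
Proof. by rewrite /MBeta_arg mulNr -fmorphV -rmorphM. Qed.

Lemma series_Mterm alpha beta kappa mu (s : R) :
  series (Mterm alpha beta kappa mu (- s%:C)) = cseries (Mcoef alpha beta kappa mu) s.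
Proof.
apply/funext => n; apply: eq_bigr => m _; rewrite /Mterm /Mcoef -!mulrA; congr (_ * (_ * _)).
by rewrite rmorphXn (exprNn s%:C) -!mulrA; congr (_ * _); exact: mulrC.
Qed.

Lemma Mcoef_rcons alpha beta kappa mu omega w :
  Mcoef alpha beta (rcons kappa omega) (rcons mu (omega + w)) =
  pochhammer_coef (Mcoef alpha beta kappa mu) omega w.
Proof.
apply/funext => m; rewrite /pochhammer_coef /Mcoef !big_rcons invfM /=; ring.
Qed.

Lemma Mseries_limE alpha beta kappa mu (s : R) (l : R[i]) :
  cseries (Mcoef alpha beta kappa mu) s n @[n --> \oo] --> (l : R[i]^o) ->
  Mseries_cvg alpha beta kappa mu (- s%:C) /\ Mseries alpha beta kappa mu (- s%:C) = l.
Proof.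
move=> cv; rewrite /Mseries_cvg /Mseries series_Mterm; split; last exact: limn_complex.
by apply/cvg_ex; exists l.
Qed.

End MSeries.

Theorem theorem3p3 (R : realType) (p q : nat)
    (kappa : p.-tuple R[i]) (mu : q.-tuple R[i])
    (alpha beta x y omega w : R[i])
    (hkappa : forall k : R[i], k \in kappa -> not_nonpos_int k)
    (hmu : forall u : R[i], u \in mu -> not_nonpos_int u)
    (halpha : 0 < complex.Re alpha)
    (hx : 0 < complex.Re x) (hy : 0 < complex.Re y)
    (homega : 0 < complex.Re omega) (hw : 0 < complex.Re w)
    (hdef : forall rho : R, 0 < rho < 1 ->
       MBeta_defined alpha beta kappa mu x y rho%:C) :
  [/\ Cintegrable01 (beta_transform_integrand omega w
        (fun rho : R => MBeta alpha beta kappa mu x y rho%:C)),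
      MBeta_defined alpha beta
        (rcons_tuple kappa omega) (rcons_tuple mu (omega + w)) x y 1
    & beta_transform omega w
        (fun rho : R => MBeta alpha beta kappa mu x y rho%:C) =
      cBeta omega w *
      MBeta alpha beta
        (rcons_tuple kappa omega) (rcons_tuple mu (omega + w)) x y 1].
Proof.
pose d := Mcoef alpha beta kappa mu.
have cvg_d : exists c : R, forall s, c <= s -> cvgn (cseries d s).
  exists 1 => s s1; have s0 : 0 < s by lra.
  (* Every s >= 1 is an admissible argument: with t = 1 / (2 s) and rho = s t (1 - t) = (1 - t) / 2,
     both t and rho lie in ]0, 1[ and rho / (t (1 - t)) = s. *)
  pose t := (2 * s)^-1; have t0 : 0 < t by rewrite invr_gt0 mulr_gt0.
  have ts : t * s = 2^-1 by rewrite /t; field; rewrite gt_eqF.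
  have t1 : t <= 2^-1 by nra.
  have r01 : 0 < s * (t * (1 - t)) < 1 by apply/andP; split; nra.
  have t01 : 0 < t < 1 by apply/andP; split; lra.
  have [cv _] := hdef _ r01; have := cv t t01; rewrite MBeta_argE.
  have tt : t * (1 - t) != 0 by rewrite mulf_neq0 ?gt_eqF//; lra.
  by rewrite (mulfK tt) /Mseries_cvg series_Mterm.
have ME (s : R) : Mseries alpha beta kappa mu (- s%:C) = entire d s.
  by have [_ ->] := Mseries_limE (@cseries_cvg _ _ cvg_d s).
have integrandE (rho t : R) : MBeta_integrand alpha beta kappa mu x y rho%:C t =
    beta_kernel x y t * entire d (rho / (t * (1 - t))).
  by rewrite /MBeta_integrand MBeta_argE ME.
have half01 : (0 : R) < 2^-1 < (1 : R) by apply/andP; split; lra.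
have int_half : Cintegrable01 (fun t => beta_kernel x y t * entire d (2^-1 / (t * (1 - t)))).
  by apply: eq_Cintegrable01 (hdef _ half01).2 => t _; exact: integrandE.
have [i1 i2 e12] := beta_transform_Fubini homega hw cvg_d hx hy int_half.
have leftE (rho : R) : 0 < rho < 1 ->
    Cintegral01 (fun t => beta_kernel omega w rho *
      (beta_kernel x y t * entire d (rho / (t * (1 - t))))) =
    beta_transform_integrand omega w (fun rho : R => MBeta alpha beta kappa mu x y rho%:C) rho.
  move=> r01; rewrite /beta_transform_integrand /MBeta -Cintegral01Z; last exact: (hdef _ r01).2.
  by apply: eq_Cintegral01 => t _; rewrite integrandE.
pose H t := (cBeta omega w)^-1 *
  Cintegral01 (fun rho => beta_kernel omega w rho * entire d (rho * (t * (1 - t))^-1)).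
have serH (t : R) : 0 < t < 1 ->
    Mseries_cvg alpha beta (rcons_tuple kappa omega) (rcons_tuple mu (omega + w)) (MBeta_arg 1 t) /\
    Mseries alpha beta (rcons_tuple kappa omega) (rcons_tuple mu (omega + w)) (MBeta_arg 1 t) = H t.
  move=> /andP[t0 t1].
  have s0 : 0 <= (t * (1 - t))^-1 by rewrite invr_ge0 mulr_ge0; lra.
  have := MBeta_argE 1 t; rewrite rmorph1 mul1r => ->.
  apply: Mseries_limE; rewrite Mcoef_rcons.
  by have [_] := beta_entire homega hw cvg_d s0.
have rightE (t : R) : 0 < t < 1 ->
    (cBeta omega w)^-1 * Cintegral01 (fun rho => beta_kernel omega w rho *
      (beta_kernel x y t * entire d (rho / (t * (1 - t))))) =
    MBeta_integrand alpha beta (rcons_tuple kappa omega) (rcons_tuple mu (omega + w)) x y 1 t.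
  move=> t01; rewrite /MBeta_integrand (serH t t01).2 /H.
  have /andP[t0 t1] := t01.
  have s0 : 0 <= (t * (1 - t))^-1 by rewrite invr_ge0 mulr_ge0; lra.
  have [i _] := beta_entire homega hw cvg_d s0.
  rewrite (_ : Cintegral01 _ = beta_kernel x y t *
    Cintegral01 (fun rho => beta_kernel omega w rho * entire d (rho * (t * (1 - t))^-1))).
    exact: mulrCA.
  by rewrite -(Cintegral01Z _ i); apply: eq_Cintegral01 => rho _; exact: mulrCA.
have B0 := cBeta_neq0 homega hw.
split.
- exact: eq_Cintegrable01 leftE i1.
- split; first by move=> t /serH[].
  (* [i2] is about B(omega, w) times the new integrand, so it is multiplied by the inverse of
     B(omega, w). *)
  exact: eq_Cintegrable01 rightE (Cintegrable01Z _ i2).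
rewrite /beta_transform -(eq_Cintegral01 leftE) e12.
have E := Cintegral01Z (cBeta omega w)^-1 i2; rewrite (eq_Cintegral01 rightE) in E.
have solve_mul (B a b : R[i]) : B != 0 -> b = B^-1 * a -> a = B * b by move=> ? ->; rewrite mulVKf.
exact: solve_mul B0 E.
Qed.
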